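(* Let $P_{\mathbb N}=(Y\;F)$ where $F=\lambda x\lambda y\,\mu\alpha\,(\alpha\;(y\;\lambda d\,(x\;(\widehat{s}\;y))\;\mathbf{id}\;(\mathcal I\;(\alpha\;(y\;\lambda d\lambda z\,(z\;y)\;\mathbf{id}\;\alpha)))))$, $Y$ is Turing's fixed point combinator $Y=(A\;A)$ with $A=\lambda u\lambda f\,(f\;(u\;u\;f))$, and $\widehat{s}$ is a $\lambda\mu^{++}$-term for the successor on Church integers. Then $(P_{\mathbb N}\;\widehat{0})\rightarrow_{\mu^{++}}\{\lambda y\,(y\;\widehat{m}) : m\in\mathbb{N}\}$.
   Context: $\lambda\mu^{++}$-terms: $t ::= x\mid\alpha\mid\lambda x\,t\mid\mu\alpha\,t\mid(t\;t)$ ($x$ $\lambda$-variables, $\alpha$ $\mu$-variables; binders $\lambda,\mu$; application left-associative). $\mathbf{id}=\lambda x\,x$, $\mathcal I=\lambda x\,\mu\alpha\,x$, and Church integers $\widehat{n}=\lambda x\lambda y\,(y^n\;x)$ with $(y^0\;x)=x$, $(y^{k+1}\;x)=(y\;(y^k\;x))$. One-step reduction $\rightharpoonup$ is the contextual closure of: $(C_\lambda)$ $(\lambda x\,u\;v)\rightharpoonup u[x:=v]$; $(C_\mu)$ $(\mu\alpha\,u\;v)\rightharpoonup\mu\beta\,u[\alpha:=\lambda y\,(\beta\;(y\;v))]$; $(S_1)$ $((\alpha\;u)\;v)\rightharpoonup(\alpha\;u)$; $(S_2)$ $\mu\alpha\mu\beta\,u\rightharpoonup\mu\alpha\,u[\beta:=\mathbf{id}]$;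 $(S_3)$ $(\alpha\;(\beta\;u))\rightharpoonup(\beta\;u)$; $(S_4)$ $(\beta\;\mu\alpha\,u)\rightharpoonup u[\alpha:=\lambda y\,(\beta\;y)]$; $(S_5)$ $\mu\alpha\,u\rightharpoonup\lambda z\,\mu\beta\,u[\alpha:=\lambda y\,(\beta\;(y\;z))]$ if $u$ contains a subterm $(\alpha\;\lambda x\,v)$; $(S_6)$ $\mu\alpha\,u[y:=(\alpha\;v)]\rightharpoonup v$ if $y$ is free in $u$ and $\alpha$ not free in $v$. $t\rightharpoonup_{\mu^{++}}t'$: finitely many steps; normal: no step applies. For a set $\mathcal V$ of normal terms, $t\rightarrow_{\mu^{++}}\mathcal V$ means $t\rightharpoonup_{\mu^{++}}u$ for all $u\in\mathcal V$ and every normal $u$ with $t\rightharpoonup_{\mu^{++}}u$ is in $\mathcal V$.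
   Formalization: The term ŝ for the successor is required to satisfy (ŝ n̂) ⇀ (n+1)^ by rule C_λ (ordinary β-reduction) alone; if all the rules were allowed in computing the successor, the claim would fail for some ŝ using μ. *)

(* Defs.v *)
(* Vanilla Stdlib.

   Terms are taken up to alpha-equivalence by means of de Bruijn indices with
   two independent index spaces: the index of a lambda-variable counts the
   enclosing [lam]s only, that of a mu-variable the enclosing [mu]s only. *)
From Stdlib Require Import Arith Relations.

Inductive term : Type :=
| lvar (n : nat)
| mvar (n : nat)
| lam (t : term)
| mu (t : term)
| app (t u : term).

(* [scons x f] maps 0 to x and n+1 to f n. *)
Definition scons {A : Type} (x : A) (f : nat -> A) (n : nat) : A :=
  match n with
  | 0 => x
  | S n' => f n'
  end.

Definition up_ren (r : nat -> nat) : nat -> nat :=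
  scons 0 (fun n => S (r n)).

Fixpoint ren (rl rm : nat -> nat) (t : term) : term :=
  match t with
  | lvar n => lvar (rl n)
  | mvar n => mvar (rm n)
  | lam u => lam (ren (up_ren rl) rm u)
  | mu u => mu (ren rl (up_ren rm) u)
  | app u v => app (ren rl rm u) (ren rl rm v)
  end.

Definition id_ren (n : nat) : nat := n.

(* Simultaneous capture-avoiding substitution of terms for the variables of
   both kinds. *)
Fixpoint subst (sl sm : nat -> term) (t : term) : term :=
  match t with
  | lvar n => sl n
  | mvar n => sm n
  | lam u => lam (subst (scons (lvar 0) (fun n => ren S id_ren (sl n)))
                        (fun n => ren S id_ren (sm n)) u)
  | mu u => mu (subst (fun n => ren id_ren S (sl n))
                      (scons (mvar 0) (fun n => ren id_ren S (sm n))) u)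
  | app u v => app (subst sl sm u) (subst sl sm v)
  end.

Fixpoint lfree (n : nat) (t : term) : Prop :=
  match t with
  | lvar m => m = n
  | mvar _ => False
  | lam u => lfree (S n) u
  | mu u => lfree n u
  | app u v => lfree n u \/ lfree n v
  end.

(* [t] contains a subterm (alpha lambda x v), where alpha is the free
   mu-variable of [t] of index [a]. *)
Fixpoint has_mvar_lam (a : nat) (t : term) : Prop :=
  match t with
  | lvar _ | mvar _ => False
  | lam u => has_mvar_lam a u
  | mu u => has_mvar_lam (S a) u
  | app u v => (u = mvar a /\ exists w, v = lam w)
               \/ has_mvar_lam a u \/ has_mvar_lam a v
  end.

Definition tm_id : term := lam (lvar 0).

Definition tm_I : term := lam (mu (lvar 0)).

Definition church (n : nat) : term :=
  lam (lam (Nat.iter n (app (lvar 0)) (lvar 1))).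

Inductive C_lambda : term -> term -> Prop :=
| C_lambda_intro u v :
    C_lambda (app (lam u) v) (subst (scons v lvar) mvar u).

(* In [C_mu] and [S5] the fresh beta takes the index that alpha had, whence
   [fun n => mvar (S n)] on the other mu-variables of u.  In [S6] the term
   mu alpha u[y:=(alpha v)] is formed from a body u whose lambda-variable 0
   is y; alpha is not free in v, which is expressed by the use of
   [ren id_ren S v], whose mu-variables avoid 0, under the binder of alpha. *)
Inductive rule : term -> term -> Prop :=
| rule_C_lambda t t' :
    C_lambda t t' -> rule t t'
| rule_C_mu u v :
    rule (app (mu u) v)
         (mu (subst lvar
                (scons (lam (app (mvar 0) (app (lvar 0) (ren S S v))))
                       (fun n => mvar (S n)))
                u))
| rule_S1 a u v :
    rule (app (app (mvar a) u) v) (app (mvar a) u)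
| rule_S2 u :
    rule (mu (mu u)) (mu (subst lvar (scons tm_id mvar) u))
| rule_S3 a b u :
    rule (app (mvar a) (app (mvar b) u)) (app (mvar b) u)
| rule_S4 b u :
    rule (app (mvar b) (mu u))
         (subst lvar (scons (lam (app (mvar b) (lvar 0))) mvar) u)
| rule_S5 u :
    has_mvar_lam 0 u ->
    rule (mu u)
         (lam (mu (subst (fun n => lvar (S n))
                     (scons (lam (app (mvar 0) (app (lvar 0) (lvar 1))))
                            (fun n => mvar (S n)))
                     u)))
| rule_S6 u v :
    lfree 0 u ->
    rule (mu (subst (scons (app (mvar 0) (ren id_ren S v)) lvar) mvar u)) v.

Inductive closure (R : term -> term -> Prop) : term -> term -> Prop :=
| closure_root t t' : R t t' -> closure R t t'
| closure_lam t t' : closure R t t' -> closure R (lam t) (lam t')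
| closure_mu t t' : closure R t t' -> closure R (mu t) (mu t')
| closure_app_l t t' u : closure R t t' -> closure R (app t u) (app t' u)
| closure_app_r t u u' : closure R u u' -> closure R (app t u) (app t u').

Definition step : term -> term -> Prop := closure rule.

Definition red : term -> term -> Prop := clos_refl_trans term step.

Definition red_lambda : term -> term -> Prop :=
  clos_refl_trans term (closure C_lambda).

Definition normal (t : term) : Prop := forall t', ~ step t t'.

Definition red_set (t : term) (V : term -> Prop) : Prop :=
  (forall u, V u -> normal u) /\
  (forall u, V u -> red t u) /\
  (forall u, normal u -> red t u -> V u).

(* [s] is a lambda-mu++-term for the successor on Church integers.  The
   reduction is by C_lambda, i.e. the usual beta-reduction: full reduction is
   non-deterministic, and knowing which terms (s n) reduces to by all the
   rules (even all its normal forms) does not determine how it behaves once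
   applied to further arguments.  For a term s without mu-binders and
   mu-variables, (s n) has only C_lambda-reductions. *)
Definition represents_succ (s : term) : Prop :=
  forall n, red_lambda (app s (church n)) (church (S n)).

Definition turing_A : term :=
  lam (lam (app (lvar 0) (app (app (lvar 1) (lvar 1)) (lvar 0)))).

Definition turing_Y : term := app turing_A turing_A.

(* lambda x lambda y mu alpha
     (alpha (y  lambda d (x (s y))  id
               (I (alpha (y  lambda d lambda z (z y)  id  alpha))))),
   where the free variables of [s] are not captured by the binders. *)
Definition F_N (s : term) : term :=
  lam (lam (mu
    (app (mvar 0)
      (app (app (app (lvar 0)
             (lam (app (lvar 2)
                       (app (ren (fun n => 3 + n) S s) (lvar 1)))))
             tm_id)
        (app tm_I
          (app (mvar 0)
            (app (app (app (lvar 0)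
                   (lam (lam (app (lvar 0) (lvar 2)))))
                   tm_id)
              (mvar 0)))))))).

Definition P_N (s : term) : term := app turing_Y (F_N s).

(* Main.v *)
From Stdlib Require Import Relations FunctionalExtensionality.
Require Import Defs.

(* Every rule but beta has a [mu] or a mu-variable in head position, so weak
   head beta-reduction commutes with arbitrary reduction.  In particular the
   terms that beta-reduce to a Church integer are stable under all the rules,
   even when subterms of [s] containing [mu] are still to be erased.

   The terms met while reducing [(P_N 0)] are described by a type system in
   which the continuation [alpha] of [F_N] is always applied to terms of the
   type of the result, so that S6, whatever occurrence of [alpha] it selects,
   yields a term of that type, and S5 is an eta-expansion that applies only at
   that type.  Recursion is handled by step-indexing: a weakly head reducible
   term is typed as soon as its one-step reducts are typed at a smaller index.
   Subject reduction holds, and a typed normal term has the form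
   [lam (app (lvar 0) (church m))].

   Conversely, S6 applied to the outer [(alpha ...)] turns [(P_N k)] into
   [(P_N (k+1))], and applied to the inner one turns it into
   [lam (app (lvar 0) (church k))]. *)

(** * Algebra of simultaneous renamings and substitutions *)

Lemma up_ren_comp r r' :
  (fun n => up_ren r' (up_ren r n)) = up_ren (fun n => r' (r n)).
Proof. now extensionality n; destruct n. Qed.

Lemma ren_ren t : forall r q r' q',
  ren r' q' (ren r q t) = ren (fun n => r' (r n)) (fun n => q' (q n)) t.
Proof.
  induction t; intros; simpl; rewrite ?IHt, ?IHt1, ?IHt2, ?up_ren_comp; reflexivity.
Qed.

Lemma subst_mu sl sm t :
  subst sl sm (mu t) = mu (subst (fun n => ren id_ren S (sl n))
                             (scons (mvar 0) (fun n => ren id_ren S (sm n))) t).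
Proof. reflexivity. Qed.

Lemma ren_subst_id t : forall r q,
  ren r q t = subst (fun n => lvar (r n)) (fun n => mvar (q n)) t.
Proof.
  induction t; intros; simpl; rewrite ?IHt, ?IHt1, ?IHt2; try reflexivity;
    do 2 f_equal; extensionality n; destruct n; reflexivity.
Qed.

Lemma up_id_ren : up_ren id_ren = id_ren.
Proof. now extensionality n; destruct n. Qed.

Lemma ren_id t : ren id_ren id_ren t = t.
Proof.
  induction t; simpl; rewrite ?up_id_ren, ?IHt, ?IHt1, ?IHt2; reflexivity.
Qed.

Lemma subst_id t : subst lvar mvar t = t.
Proof. rewrite <- (ren_id t) at 2. now rewrite ren_subst_id. Qed.

Lemma subst_ren t : forall sl sm r q,
  subst sl sm (ren r q t) = subst (fun n => sl (r n)) (fun n => sm (q n)) t.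
Proof.
  induction t; intros; simpl; rewrite ?IHt, ?IHt1, ?IHt2; try reflexivity;
    do 2 f_equal; extensionality n; destruct n; reflexivity.
Qed.

Lemma ren_subst t : forall sl sm r q,
  ren r q (subst sl sm t)
  = subst (fun n => ren r q (sl n)) (fun n => ren r q (sm n)) t.
Proof.
  induction t; intros; simpl; rewrite ?IHt, ?IHt1, ?IHt2; try reflexivity;
    do 2 f_equal; extensionality n; try (destruct n; [reflexivity|]); simpl;
    rewrite !ren_ren; reflexivity.
Qed.

Lemma subst_subst t : forall sl sm sl' sm',
  subst sl' sm' (subst sl sm t)
  = subst (fun n => subst sl' sm' (sl n)) (fun n => subst sl' sm' (sm n)) t.
Proof.
  induction t; intros; simpl; rewrite ?IHt, ?IHt1, ?IHt2; try reflexivity;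
    do 2 f_equal; extensionality n; try (destruct n; [reflexivity|]); simpl;
    rewrite subst_ren, ren_subst; reflexivity.
Qed.

(** * Free variables *)

(** Binders extend the predicates by [True], so only free variables are constrained. This serves to
    compare substitutions on the variables that matter and, later, to confine a term to variables of
    unknown type. *)
Fixpoint pure (pl pm : nat -> Prop) (t : term) : Prop :=
  match t with
  | lvar n => pl n
  | mvar n => pm n
  | lam u => pure (scons True pl) pm u
  | mu u => pure pl (scons True pm) u
  | app u v => pure pl pm u /\ pure pl pm v
  end.

Lemma scons_up_ren (pl : nat -> Prop) r :
  (fun n => scons True pl (up_ren r n)) = scons True (fun n => pl (r n)).
Proof. now extensionality n; destruct n. Qed.

Lemma pure_ren t : forall pl pm r q,
  pure pl pm (ren r q t) <-> pure (fun n => pl (r n)) (fun n => pm (q n)) t.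
Proof.
  induction t; intros; simpl; rewrite ?IHt, ?IHt1, ?IHt2, ?scons_up_ren; tauto.
Qed.

Lemma pure_impl t : forall (pl pm pl' pm' : nat -> Prop),
  (forall n, pl n -> pl' n) -> (forall n, pm n -> pm' n) ->
  pure pl pm t -> pure pl' pm' t.
Proof.
  induction t; simpl; intros pl pm pl' pm' Hl Hm H; auto.
  - eapply IHt; [| |exact H]; auto. intros [|n]; simpl; auto.
  - eapply IHt; [| |exact H]; auto. intros [|n]; simpl; auto.
  - destruct H; eauto.
Qed.

Lemma pure_subst t : forall (pl pm pl' pm' : nat -> Prop) sl sm,
  (forall n, pl n -> pure pl' pm' (sl n)) ->
  (forall n, pm n -> pure pl' pm' (sm n)) ->
  pure pl pm t -> pure pl' pm' (subst sl sm t).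
Proof.
  induction t; simpl; intros pl pm pl' pm' sl sm Hl Hm H; auto.
  - eapply IHt; [| |exact H].
    + intros [|n]; simpl; auto. intros Hn. apply pure_ren. now apply Hl.
    + intros n Hn. apply pure_ren. now apply Hm.
  - eapply IHt; [| |exact H].
    + intros n Hn. apply pure_ren. now apply Hl.
    + intros [|n]; simpl; auto. intros Hn. apply pure_ren. now apply Hm.
  - destruct H; split; eauto.
Qed.

Lemma subst_pure_ext t : forall (pl pm : nat -> Prop) sl sm sl' sm',
  (forall n, pl n -> sl n = sl' n) -> (forall n, pm n -> sm n = sm' n) ->
  pure pl pm t -> subst sl sm t = subst sl' sm' t.
Proof.
  induction t; simpl; intros pl pm sl sm sl' sm' Hl Hm H; auto.
  - f_equal. eapply IHt; [| |exact H].
    + intros [|n]; simpl; auto. intros Hn. now rewrite Hl.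
    + intros n Hn. now rewrite Hm.
  - f_equal. eapply IHt; [| |exact H].
    + intros n Hn. now rewrite Hl.
    + intros [|n]; simpl; auto. intros Hn. now rewrite Hm.
  - destruct H; f_equal; eauto.
Qed.

Lemma subst_pure_id t (pl pm : nat -> Prop) sl sm :
  (forall n, pl n -> sl n = lvar n) -> (forall n, pm n -> sm n = mvar n) ->
  pure pl pm t -> subst sl sm t = t.
Proof.
  intros Hl Hm H. rewrite (subst_pure_ext _ pl pm sl sm lvar mvar); auto using subst_id.
Qed.

Lemma pure_true t : pure (fun _ => True) (fun _ => True) t.
Proof.
  assert (E : scons True (fun _ => True) = fun _ => True)
    by (extensionality n; destruct n; reflexivity).
  induction t; simpl; rewrite ?E; auto.
Qed.

(* [occ w t]: [w] occurs in [t], and its free variables are free in [t] too. *)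
Inductive occ : term -> term -> Prop :=
| occ_here w : occ w w
| occ_lam w t : occ (ren S id_ren w) t -> occ w (lam t)
| occ_mu w t : occ (ren id_ren S w) t -> occ w (mu t)
| occ_app_l w t u : occ w t -> occ w (app t u)
| occ_app_r w t u : occ w u -> occ w (app t u).

Lemma occ_subst u : forall n sl sm, lfree n u -> occ (sl n) (subst sl sm u).
Proof.
  induction u; simpl; intros k sl sm H; try contradiction.
  - subst. constructor.
  - constructor. exact (IHu (S k) (scons (lvar 0) _) _ H).
  - constructor. exact (IHu k (fun n => ren id_ren S (sl n)) _ H).
  - destruct H; [apply occ_app_l|apply occ_app_r]; auto.
Qed.

Lemma occ_pure w t : occ w t -> forall pl pm, pure pl pm t -> pure pl pm w.
Proof.
  induction 1; simpl; intros pl pm Hp; try tauto.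
  - apply IHocc in Hp. apply -> pure_ren in Hp. exact Hp.
  - apply IHocc in Hp. apply -> pure_ren in Hp. exact Hp.
  - apply IHocc; tauto.
  - apply IHocc; tauto.
Qed.

(** The left-hand side of S6 is a substitution instance, which inversion cannot take apart. The
    analyses of S6 redexes rely only on the selected jump occurring in the body. *)
Lemma occ_S6 u v :
  lfree 0 u ->
  occ (app (mvar 0) (ren id_ren S v))
      (subst (scons (app (mvar 0) (ren id_ren S v)) lvar) mvar u).
Proof. intros H. exact (occ_subst u 0 (scons _ _) mvar H). Qed.

Lemma pure_has_mvar_lam t : forall a pl pm,
  pure pl pm t -> has_mvar_lam a t -> pm a.
Proof.
  induction t; simpl; intros a pl pm H Hh; try contradiction.
  - exact (IHt _ _ _ H Hh).
  - exact (IHt _ _ _ H Hh).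
  - destruct H as [H1 H2]. destruct Hh as [[-> _]|[Hh|Hh]];
      [exact H1|exact (IHt1 _ _ _ H1 Hh)|exact (IHt2 _ _ _ H2 Hh)].
Qed.

Lemma rule_pure t t' : rule t t' -> forall pl pm, pure pl pm t -> pure pl pm t'.
Proof.
  intros R pl pm H. destruct R; simpl in *.
  - match goal with R : C_lambda _ _ |- _ => destruct R as [u v] end.
    destruct H as [Hu Hv].
    eapply pure_subst; [| |exact Hu]; [intros [|n]|]; simpl; auto.
  - destruct H as [Hu Hv]. eapply pure_subst; [| |exact Hu]; [|intros [|n]]; simpl; auto.
    intros _. repeat split. apply pure_ren. exact Hv.
  - tauto.
  - eapply pure_subst; [| |exact H]; [|intros [|n]]; simpl; auto.
  - tauto.
  - destruct H as [Hb Hu]. eapply pure_subst; [| |exact Hu]; [|intros [|n]]; simpl; auto.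
  - eapply pure_subst; [| |exact H]; [|intros [|n]]; simpl; auto.
  - apply (occ_pure _ _ (occ_S6 _ v H0)) in H. destruct H as [_ H].
    apply -> pure_ren in H. exact H.
Qed.

(** * Parallel reduction *)

(* One bottom-up pass: reduce the immediate subterms, then optionally fire a
   rule at the root. *)
Inductive par : term -> term -> Prop :=
| par_lvar n : par (lvar n) (lvar n)
| par_mvar n : par (mvar n) (mvar n)
| par_lam t t' : par t t' -> par (lam t) (lam t')
| par_mu t t' : par t t' -> par (mu t) (mu t')
| par_app t t' u u' : par t t' -> par u u' -> par (app t u) (app t' u')
| par_mu_rule t t' w : par t t' -> rule (mu t') w -> par (mu t) w
| par_app_rule t t' u u' w :
    par t t' -> par u u' -> rule (app t' u') w -> par (app t u) w.

Lemma par_refl t : par t t.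
Proof. induction t; constructor; auto. Qed.

Lemma step_par t t' : step t t' -> par t t'.
Proof.
  induction 1; try (constructor; auto using par_refl; fail).
  destruct t as [n|n|t|t|t u].
  - inversion H; inversion H0.
  - inversion H; inversion H0.
  - inversion H; inversion H0.
  - eapply par_mu_rule; eauto using par_refl.
  - eapply par_app_rule; eauto using par_refl.
Qed.

Lemma par_pure t t' : par t t' -> forall pl pm, pure pl pm t -> pure pl pm t'.
Proof.
  induction 1; simpl; intros pl pm Hp; auto.
  - destruct Hp; auto.
  - eapply rule_pure; [eassumption|]. simpl; auto.
  - eapply rule_pure; [eassumption|]. simpl. destruct Hp; auto.
Qed.

Lemma lfree_subst t : forall n sl sm m,
  sl n = lvar m -> lfree n t -> lfree m (subst sl sm t).
Proof.
  induction t; simpl; intros k sl sm m E H; try contradiction.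
  - subst. rewrite E. reflexivity.
  - eapply IHt; [|exact H]. simpl. now rewrite E.
  - eapply IHt; [|exact H]. simpl. now rewrite E.
  - destruct H; eauto.
Qed.

Lemma has_mvar_lam_subst t : forall a sl sm b,
  sm a = mvar b -> has_mvar_lam a t -> has_mvar_lam b (subst sl sm t).
Proof.
  induction t; simpl; intros a sl sm b E H; try contradiction.
  - eapply IHt; [|exact H]. simpl. now rewrite E.
  - eapply IHt; [|exact H]. simpl. now rewrite E.
  - destruct H as [[-> [w ->]]|[H|H]]; [left|right; left|right; right]; eauto.
    simpl. rewrite E. eauto.
Qed.

Lemma C_lambda_subst t t' sl sm :
  C_lambda t t' -> C_lambda (subst sl sm t) (subst sl sm t').
Proof.
  intros []. simpl.
  rewrite subst_subst.
  match goal with |- C_lambda (app (lam ?a) ?b) ?c =>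
    replace c with (subst (scons b lvar) mvar a); [constructor|] end.
  rewrite subst_subst. f_equal; extensionality n; try (destruct n; [reflexivity|]); simpl;
    rewrite subst_ren; apply subst_id.
Qed.

Lemma rule_eq t t' u u' : rule t t' -> t = u -> t' = u' -> rule u u'.
Proof. now intros ? <- <-. Qed.


Lemma subst_ext t sl sm sl' sm' :
  (forall n, sl n = sl' n) -> (forall n, sm n = sm' n) ->
  subst sl sm t = subst sl' sm' t.
Proof. intros. eapply subst_pure_ext; eauto using pure_true. Qed.

Lemma ren_ext t r q r' q' :
  (forall n, r n = r' n) -> (forall n, q n = q' n) -> ren r q t = ren r' q' t.
Proof. intros. rewrite !ren_subst_id. apply subst_ext; congruence. Qed.

Lemma subst_eq_id t sl sm :
  (forall n, sl n = lvar n) -> (forall n, sm n = mvar n) -> subst sl sm t = t.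
Proof. intros. rewrite (subst_ext _ _ _ lvar mvar); auto using subst_id. Qed.

Ltac subst_norm :=
  simpl; unfold id_ren; repeat (rewrite subst_ren || rewrite ren_subst
    || rewrite ren_ren || rewrite subst_subst); simpl.

(** Each side is fused into a single simultaneous substitution or renaming; these are then compared
    pointwise, splitting indices into zero and successor where needed. *)
Ltac subst_eq :=
  match goal with
  | |- forall n : nat, _ => first [intros [|n]; subst_eq | intros n; subst_eq]
  | |- _ => subst_norm;
    match goal with
    | |- _ => reflexivity
    | |- subst _ _ ?t = ?t => apply subst_eq_id; subst_eq
    | |- ren _ _ ?t = subst _ _ ?t => rewrite ren_subst_id; apply subst_ext; subst_eq
    | |- subst _ _ ?t = ren _ _ ?t => rewrite ren_subst_id; apply subst_ext; subst_eq
    | |- subst _ _ ?t = subst _ _ ?t => apply subst_ext; subst_eq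
    | |- ren _ _ ?t = ren _ _ ?t => apply ren_ext; subst_eq
    | |- lam _ = lam _ => f_equal; subst_eq
    | |- mu _ = mu _ => f_equal; subst_eq
    | |- app _ _ = app _ _ => f_equal; subst_eq
    end
  end.

(** The mu-variables are only renamed: S1, S3 and S4 need a mu-variable in head position, which an
    arbitrary term put in its place would destroy. *)
Lemma rule_subst t t' sl q :
  rule t t' ->
  rule (subst sl (fun n => mvar (q n)) t) (subst sl (fun n => mvar (q n)) t').
Proof.
  intros R; destruct R.
  - constructor. now apply C_lambda_subst.
  - eapply rule_eq; [apply rule_C_mu|reflexivity|]. subst_eq.
  - apply rule_S1.
  - eapply rule_eq; [apply rule_S2|reflexivity|]. subst_eq.
  - apply rule_S3.
  - eapply rule_eq; [apply rule_S4|reflexivity|]. subst_eq.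
  - eapply rule_eq; [apply rule_S5|reflexivity|].
    + eapply has_mvar_lam_subst; [|eassumption]. reflexivity.
    + subst_eq.
  - eapply rule_eq;
      [eapply (rule_S6 (subst (scons (lvar 0) (fun n => ren S S (sl n)))
                          (scons (mvar 0) (fun n => mvar (S (q n)))) u)
                   (subst sl (fun n => mvar (q n)) v))
      | |reflexivity].
    + eapply lfree_subst; [|eassumption]. reflexivity.
    + subst_eq.
Qed.

Lemma rule_ren t t' r q : rule t t' -> rule (ren r q t) (ren r q t').
Proof. rewrite !ren_subst_id. apply rule_subst. Qed.

Lemma par_ren t t' : par t t' -> forall r q, par (ren r q t) (ren r q t').
Proof.
  induction 1; intros r q; simpl; try (constructor; auto; fail).
  - eapply par_mu_rule; [apply IHpar|]. exact (rule_ren _ _ r q H0).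
  - eapply par_app_rule; [apply IHpar1|apply IHpar2|]. exact (rule_ren _ _ r q H1).
Qed.

Lemma par_subst t t' :
  par t t' -> forall sl sl' q, (forall n, par (sl n) (sl' n)) ->
  par (subst sl (fun n => mvar (q n)) t) (subst sl' (fun n => mvar (q n)) t').
Proof.
  assert (E : forall q, scons (mvar 0) (fun n => mvar (S (q n)))
                        = fun n => mvar (up_ren q n))
    by (intros q; extensionality n; now destruct n).
  induction 1; intros sl sl' q Hs; simpl.
  - apply Hs.
  - apply par_refl.
  - constructor. apply (IHpar _ _ q). intros [|n]; simpl; auto using par_lvar, par_ren.
  - constructor. rewrite !E. apply IHpar. intros n; simpl; auto using par_ren.
  - constructor; auto.
  - eapply par_mu_rule; [|exact (rule_subst _ _ sl' q H0)]; simpl.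
    rewrite !E. apply IHpar. intros n; simpl; auto using par_ren.
  - eapply par_app_rule; [apply IHpar1|apply IHpar2|exact (rule_subst _ _ sl' q H1)]; auto.
Qed.

Lemma par_beta t t' u u' :
  par t t' -> par u u' ->
  par (subst (scons u lvar) mvar t) (subst (scons u' lvar) mvar t').
Proof.
  intros Ht Hu. apply (par_subst _ _ Ht _ _ (fun n => n)).
  intros [|n]; simpl; auto using par_lvar.
Qed.

(** * Weak head reduction *)

Inductive wh : term -> term -> Prop :=
| wh_beta u v : wh (app (lam u) v) (subst (scons v lvar) mvar u)
| wh_app t t' u : wh t t' -> wh (app t u) (app t' u).

Definition can_wh (t : term) : Prop := exists t', wh t t'.

(* Apart from beta, the head of every redex is a [mu] or a mu-variable, so
   that only beta can fire on the weak head path of [t]. *)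
Lemma par_wh t t' t1 :
  par t t' -> wh t t1 ->
  (exists t1', wh t' t1' /\ par t1 t1') \/ par t1 t'.
Proof.
  intros P; revert t1. induction P; intros t1 W; inversion W; subst.
  - inversion P1; subst. left. eexists. split; [constructor|]. now apply par_beta.
  - destruct (IHP1 _ H2) as [[w [Hw Pw]]|Pw].
    + left. eexists. split; [apply wh_app; eassumption|]. now constructor.
    + right. now constructor.
  - inversion P1; subst. right. inversion H; subst.
    inversion H0; subst. now apply par_beta.
  - destruct (IHP1 _ H3) as [[w0 [Hw Pw]]|Pw].
    (* In a root redex the function part is an abstraction, a [mu], a mu-variable or a mu-variable
       applied once, none of which has a weak head step. *)
    + exfalso. inversion H; subst; try (inversion H0; subst); inversion Hw; subst;
      match goal with H : wh _ _ |- _ => now inversion H end.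
    + right. eapply par_app_rule; eassumption.
Qed.

Inductive whs : term -> term -> Prop :=
| whs_refl t : whs t t
| whs_step t u v : wh t u -> whs u v -> whs t v.

Lemma whs_app t t' u : whs t t' -> whs (app t u) (app t' u).
Proof. induction 1; [apply whs_refl|]. eapply whs_step; [|eassumption]. now constructor. Qed.

Lemma whs_trans t u v : whs t u -> whs u v -> whs t v.
Proof.
  intros H1 H2. induction H1; auto. eapply whs_step; eauto.
Qed.

Lemma wh_subst t t' sl sm : wh t t' -> wh (subst sl sm t) (subst sl sm t').
Proof.
  induction 1; simpl; [|now constructor].
  match goal with |- wh (app (lam ?a) ?b) ?c =>
    replace c with (subst (scons b lvar) mvar a); [constructor|] end.
  subst_eq.
Qed.

Lemma whs_subst t t' sl sm : whs t t' -> whs (subst sl sm t) (subst sl sm t').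
Proof.
  induction 1; [apply whs_refl|]. eapply whs_step; eauto using wh_subst.
Qed.

Lemma wh_ren t t' r q : wh t t' -> wh (ren r q t) (ren r q t').
Proof. rewrite !ren_subst_id. apply wh_subst. Qed.

Lemma can_wh_ren_inv t r q : can_wh (ren r q t) -> can_wh t.
Proof.
  induction t as [n|n|t IH|t IH|t IHt u IHu]; intros [t' H]; simpl in H; inversion H; subst.
  - destruct t; try discriminate. eexists; constructor.
  - destruct IHt as [w Hw]; [eexists; eassumption|]. eexists; constructor; eassumption.
Qed.

(** Iterates [par_wh]: each head step is either matched after the parallel step or already contained
    in it. *)
Lemma whs_par t u t' :
  whs t u -> par t t' -> exists u', whs t' u' /\ par u u'.
Proof.
  intros H. revert t'. induction H as [t|t t1 u W H IH]; intros t' P.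
  - exists t'. split; [apply whs_refl|assumption].
  - destruct (par_wh _ _ _ P W) as [[t1' [W' P']]|P'].
    + destruct (IH _ P') as [u' [Hu Pu]]. exists u'. split; auto. eapply whs_step; eauto.
    + destruct (IH _ P') as [u' [Hu Pu]]. exists u'. auto.
Qed.

(** * Standardization of beta *)

(** Standard beta-reduction in inductive form: weak head reduction exposes the root constructor of
    the target, then the subterms are reduced in the same way. *)
Inductive st : term -> term -> Prop :=
| st_lvar t n : whs t (lvar n) -> st t (lvar n)
| st_mvar t n : whs t (mvar n) -> st t (mvar n)
| st_lam t a a' : whs t (lam a) -> st a a' -> st t (lam a')
| st_mu t a a' : whs t (mu a) -> st a a' -> st t (mu a')
| st_app t a a' b b' :
    whs t (app a b) -> st a a' -> st b b' -> st t (app a' b').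

Lemma st_refl t : st t t.
Proof. induction t; econstructor; eauto; apply whs_refl. Qed.

Lemma whs_st t u v : whs t u -> st u v -> st t v.
Proof. intros H S; destruct S; econstructor; eauto using whs_trans. Qed.

Lemma whs_ren t t' r q : whs t t' -> whs (ren r q t) (ren r q t').
Proof. rewrite !ren_subst_id. apply whs_subst. Qed.

Lemma st_ren t t' : st t t' -> forall r q, st (ren r q t) (ren r q t').
Proof.
  induction 1; intros r q; apply (whs_ren _ _ r q) in H; simpl in *; econstructor; eauto.
Qed.

Lemma st_subst t t' : st t t' -> forall sl sl' sm,
  (forall n, st (sl n) (sl' n)) -> st (subst sl sm t) (subst sl' sm t').
Proof.
  induction 1; intros sl sl' sm Hs; apply (whs_subst _ _ sl sm) in H; simpl in *.
  - eapply whs_st; [exact H|apply Hs].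
  - eapply whs_st; [exact H|apply st_refl].
  - econstructor; [exact H|]. apply IHst. intros [|n]; simpl; auto using st_refl, st_ren.
  - econstructor; [exact H|]. apply IHst. intros n; simpl; auto using st_ren.
  - econstructor; [exact H| |]; auto.
Qed.

(** A beta step appended to a standard reduction can be absorbed: at the root, the two [whs]
    prefixes bring the redex to the head, and [st_subst] handles its contractum. Standardization
    follows by iteration. *)
Lemma st_step u u' : closure C_lambda u u' -> forall t, st t u -> st t u'.
Proof.
  induction 1; intros w Hw.
  - destruct H as [u v]. inversion Hw; subst. inversion H3; subst.
    eapply whs_st; [eapply whs_trans; [exact H1|apply whs_app; eassumption]|].
    eapply whs_st; [eapply whs_step; [constructor|apply whs_refl]|].
    apply st_subst; auto. intros [|n]; simpl; auto using st_refl.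
  - inversion Hw; subst; econstructor; eauto.
  - inversion Hw; subst; econstructor; eauto.
  - inversion Hw; subst; econstructor; eauto.
  - inversion Hw; subst; econstructor; eauto.
Qed.

Lemma red_lambda_st t u : red_lambda t u -> st t u.
Proof.
  intros H. apply clos_rt_rtn1 in H. induction H; eauto using st_refl, st_step.
Qed.

Lemma closure_map (R : term -> term -> Prop) f :
  (forall t t', R t t' -> R (f t) (f t')) ->
  forall t t', clos_refl_trans term R t t' -> clos_refl_trans term R (f t) (f t').
Proof.
  intros H t t' C. induction C; eauto using clos_refl_trans.
Qed.

Lemma whs_red_lambda t u : whs t u -> red_lambda t u.
Proof.
  induction 1; [apply rt_refl|]. eapply rt_trans; [apply rt_step|eassumption].
  clear -H. induction H; [apply closure_root|apply closure_app_l]; auto using C_lambda.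
Qed.

Lemma red_lambda_app t t' u u' :
  red_lambda t t' -> red_lambda u u' -> red_lambda (app t u) (app t' u').
Proof.
  intros H1 H2. eapply rt_trans.
  - apply (closure_map _ (fun t => app t u)); [intros; now apply closure_app_l|exact H1].
  - apply (closure_map _ (app t')); [intros; now apply closure_app_r|exact H2].
Qed.

Lemma st_red_lambda t u : st t u -> red_lambda t u.
Proof.
  induction 1; (eapply rt_trans; [apply whs_red_lambda; eassumption|]).
  - apply rt_refl.
  - apply rt_refl.
  - apply (closure_map _ lam); [intros; now apply closure_lam|assumption].
  - apply (closure_map _ mu); [intros; now apply closure_mu|assumption].
  - now apply red_lambda_app.
Qed.

(** * Church integers *)

(** Beta-reducibility to a Church integer, stated with [st] so that the weak head reductions
    exposing the numeral are directly available. *)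
Definition chN (y : term) : Prop := exists k, st y (church k).

Lemma succ_chN s y : represents_succ s -> chN y -> chN (app s y).
Proof.
  intros Hs [k Hk]. exists (S k). apply red_lambda_st. eapply rt_trans; [|apply Hs].
  apply red_lambda_app; [apply rt_refl|now apply st_red_lambda].
Qed.

Lemma subst_church k sl sm : subst sl sm (church k) = church k.
Proof.
  unfold church; simpl. do 2 f_equal. induction k; simpl; f_equal; auto.
Qed.

Lemma ren_church k r q : ren r q (church k) = church k.
Proof. rewrite ren_subst_id. apply subst_church. Qed.

Lemma chN_subst y sl sm : chN y -> chN (subst sl sm y).
Proof.
  intros [k Hk]. exists k. rewrite <- (subst_church k sl sm).
  apply st_subst; auto using st_refl.
Qed.

Lemma chN_ren y r q : chN y -> chN (ren r q y).
Proof. rewrite ren_subst_id. apply chN_subst. Qed.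

Lemma st_lvar_inv t n : st t (lvar n) -> whs t (lvar n).
Proof. now inversion 1. Qed.

Lemma st_lam_inv t b : st t (lam b) -> exists a, whs t (lam a) /\ st a b.
Proof. inversion 1; eauto. Qed.

Lemma st_lvar_app_inv t n c :
  st t (app (lvar n) c) -> exists a b, whs t (app a b) /\ whs a (lvar n) /\ st b c.
Proof. inversion 1; subst. eexists _, _. eauto using st_lvar_inv. Qed.

(** Weak head reduction commutes with [par], so [t'] still reaches the same head lambda-variable; no
    rule fires on an application headed by it, and its argument is covered by induction. *)
Lemma iter_par k : forall t t',
  st t (Nat.iter k (app (lvar 0)) (lvar 1)) -> par t t' ->
  st t' (Nat.iter k (app (lvar 0)) (lvar 1)).
Proof.
  induction k; simpl; intros t t' H P.
  - apply st_lvar_inv in H. destruct (whs_par _ _ _ H P) as [u [Hu Pu]].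
    inversion Pu; subst. now constructor.
  - apply st_lvar_app_inv in H. destruct H as [a [b [H [Ha Hb]]]].
    destruct (whs_par _ _ _ (whs_trans _ _ _ H (whs_app _ _ b Ha)) P) as [u [Hu Pu]].
    inversion Pu as [| | | |? ? ? ? Pa Pb| |? ? ? ? ? Pa Pb R]; subst;
      inversion Pa; subst.
    + eapply st_app; [exact Hu|apply st_refl|eauto].
    + inversion R as [? ? C| | | | | | |]; subst. inversion C.
Qed.

Lemma chN_par y y' : chN y -> par y y' -> chN y'.
Proof.
  intros [k H] P. exists k.
  apply st_lam_inv in H. destruct H as [a [H Ha]].
  apply st_lam_inv in Ha. destruct Ha as [b [Ha Hb]].
  destruct (whs_par _ _ _ H P) as [u [Hu Pu]]. inversion Pu as [| |? ? Pa| | | |]; subst.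
  destruct (whs_par _ _ _ Ha Pa) as [v [Hv Pv]]. inversion Pv as [| |? ? Pb| | | |]; subst.
  eapply st_lam; [exact Hu|]. eapply st_lam; [exact Hv|]. eapply iter_par; eassumption.
Qed.

Lemma iter_whs k A : forall t sl sm,
  sl 0 = tm_id -> sl 1 = A -> st t (Nat.iter k (app (lvar 0)) (lvar 1)) ->
  whs (subst sl sm t) A.
Proof.
  induction k; simpl; intros t sl sm E0 E1 H.
  - apply st_lvar_inv in H. apply (whs_subst _ _ sl sm) in H. simpl in H. congruence.
  - apply st_lvar_app_inv in H. destruct H as [a [b [H [Ha Hb]]]].
    apply (whs_subst _ _ sl sm) in H, Ha. simpl in H, Ha. rewrite E0 in Ha.
    eapply whs_trans; [exact H|]. eapply whs_trans; [apply whs_app; exact Ha|].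
    eapply whs_step; [constructor|]. simpl. now apply IHk.
Qed.

(** Iterating the identity on [A] gives back [A] whatever the integer. This is how both selectors in
    the body of [F_N] reach their first argument. *)
Lemma chN_iter y A : chN y -> whs (app (app y A) tm_id) A.
Proof.
  intros [k H].
  apply st_lam_inv in H. destruct H as [a [H Ha]].
  apply st_lam_inv in Ha. destruct Ha as [b [Ha Hb]].
  eapply whs_trans; [apply whs_app, whs_app; exact H|].
  eapply whs_step; [apply wh_app, wh_beta|].
  eapply whs_trans; [apply whs_app, whs_subst; exact Ha|]. simpl.
  eapply whs_step; [apply wh_beta|].
  rewrite subst_subst. eapply iter_whs; [| |exact Hb]; try reflexivity.
  subst_eq.
Qed.

(** * Normal terms *)

Lemma wh_step t t' : wh t t' -> step t t'.
Proof. induction 1; [do 2 constructor; constructor|now apply closure_app_l]. Qed.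

Lemma whs_normal t u : whs t u -> normal t -> t = u.
Proof.
  intros [|? ? ? W _] N; [reflexivity|]. apply wh_step in W. now apply N in W.
Qed.

Lemma can_wh_normal t : can_wh t -> ~ normal t.
Proof. intros [t' W] N. exact (N _ (wh_step _ _ W)). Qed.

Lemma normal_lam t : normal (lam t) -> normal t.
Proof. intros N t' H. apply (N (lam t')). now constructor. Qed.

Lemma normal_mu t : normal (mu t) -> normal t.
Proof. intros N t' H. apply (N (mu t')). now constructor. Qed.

Lemma normal_app t u : normal (app t u) -> normal t /\ normal u.
Proof.
  intros N. split; intros w H.
  - apply (N (app w u)). now constructor.
  - apply (N (app t w)). now constructor.
Qed.

(** A normal term has no weak head step, so every [whs] inside the standard reduction is trivial. *)
Lemma iter_normal k : forall t,
  st t (Nat.iter k (app (lvar 0)) (lvar 1)) -> normal t ->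
  t = Nat.iter k (app (lvar 0)) (lvar 1).
Proof.
  induction k; simpl; intros t H N.
  - apply st_lvar_inv in H. exact (whs_normal _ _ H N).
  - apply st_lvar_app_inv in H. destruct H as [a [b [H [Ha Hb]]]].
    apply whs_normal in H; auto. subst. apply normal_app in N. destruct N as [Na Nb].
    apply whs_normal in Ha; auto. subst. f_equal. auto.
Qed.

Lemma chN_normal y : chN y -> normal y -> exists k, y = church k.
Proof.
  intros [k H] N. exists k.
  apply st_lam_inv in H. destruct H as [a [H Ha]].
  apply whs_normal in H; auto; subst. apply normal_lam in N.
  apply st_lam_inv in Ha. destruct Ha as [b [Ha Hb]].
  apply whs_normal in Ha; auto; subst. apply normal_lam in N.
  unfold church. do 2 f_equal. now apply iter_normal.
Qed.

Lemma normal_church_result m : normal (lam (app (lvar 0) (church m))).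
Proof.
  assert (I : forall k t, ~ step (Nat.iter k (app (lvar 0)) (lvar 1)) t).
  { induction k; simpl; intros t H; inversion H as [? ? R| | |? ? ? H'|? ? ? H']; subst.
    - inversion R as [? ? C| | | | | | |]; inversion C.
    - inversion R as [? ? C| | | | | | |]; inversion C.
    - inversion H' as [? ? R| | | |]; subst.
      inversion R as [? ? C| | | | | | |]; inversion C.
    - exact (IHk _ H'). }
  assert (L : forall t u, (forall w, ~ step t w) -> ~ step (lam t) u).
  { intros t u N H. inversion H as [? ? R|? ? H'| | |]; subst.
    - inversion R as [? ? C| | | | | | |]; inversion C.
    - exact (N _ H'). }
  intros t. apply L. intros w H. inversion H as [? ? R| | |? ? ? H'|? ? ? H']; subst.
  - inversion R as [? ? C| | | | | | |]; inversion C.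
  - inversion H' as [? ? R| | | |]; subst. inversion R as [? ? C| | | | | | |]; inversion C.
  - revert H'. apply L. intros ?. apply L. apply I.
Qed.

(** * Typing *)

(* [sN] is the type of the computed integers, terms that send a continuation
   [z] to an answer, and [sO] is the type of answers. *)
Inductive sort := sN | sO.

(* Variables of type [LD] or [MD] are those of [s], on which nothing is known;
   [LZ] is the type of the continuations [z]; [LN] and [MN] are for variables
   that do not occur. *)
Inductive ltype := LD | LZ | LV (b : sort) | LN.
Inductive mtype := MD | MV (b : sort) | MN.

(* [kT]: terms of a sort, [kK]: functions from a sort to jumps, [kU]: jumps,
   [kE]: functions that erase their argument and yield a term of sort [sN],
   [kW]: the arguments which they erase. *)
Inductive kind := kT (b : sort) | kK (b : sort) | kU | kW | kE.

Definition dl (Gl : nat -> ltype) (n : nat) : Prop := Gl n = LD.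
Definition dm (Gm : nat -> mtype) (n : nat) : Prop := Gm n = MD.

(* The index [L] bounds the number of parallel steps for which the typing is
   guaranteed: nothing is known of a weakly head reducible term, except how
   its reducts are typed. *)
Inductive ty : nat -> (nat -> ltype) -> (nat -> mtype) -> kind -> term -> Prop :=
| ty_delay L Gl Gm k t :
    pure (dl Gl) (dm Gm) t -> can_wh t ->
    (forall L' t', L = S L' -> par t t' -> ty L' Gl Gm k t') ->
    ty L Gl Gm k t
| ty_var L Gl Gm b n : Gl n = LV b -> ty L Gl Gm (kT b) (lvar n)
| ty_mu L Gl Gm b u : ty L Gl (scons (MV b) Gm) kU u -> ty L Gl Gm (kT b) (mu u)
| ty_erase L Gl Gm e w :
    ty L Gl Gm kE e -> ty L Gl Gm kW w -> ty L Gl Gm (kT sN) (app e w)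
| ty_lam L Gl Gm o : ty L (scons LZ Gl) Gm (kT sO) o -> ty L Gl Gm (kT sN) (lam o)
| ty_zy L Gl Gm n y :
    Gl n = LZ -> pure (dl Gl) (dm Gm) y -> chN y ->
    ty L Gl Gm (kT sO) (app (lvar n) y)
| ty_inst L Gl Gm p n :
    Gl n = LZ -> ty L Gl Gm (kT sN) p -> ty L Gl Gm (kT sO) (app p (lvar n))
| ty_jump L Gl Gm b k t :
    ty L Gl Gm (kK b) k -> ty L Gl Gm (kT b) t -> ty L Gl Gm kU (app k t)
| ty_kvar L Gl Gm b a : Gm a = MV b -> ty L Gl Gm (kK b) (mvar a)
| ty_klam L Gl Gm b u : ty L (scons (LV b) Gl) Gm kU u -> ty L Gl Gm (kK b) (lam u)
| ty_wk L Gl Gm b k : ty L Gl Gm (kK b) k -> ty L Gl Gm kW k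
| ty_wI L Gl Gm u : ty L Gl Gm kU u -> ty L Gl Gm kW (app tm_I u)
| ty_wmu L Gl Gm u : ty L Gl (scons MN Gm) kU u -> ty L Gl Gm kW (mu u)
| ty_elam L Gl Gm t : ty L (scons LN Gl) Gm (kT sN) t -> ty L Gl Gm kE (lam t).

(** * Typing under renaming and substitution *)

Lemma ren_pure_id t (pl pm : nat -> Prop) r q :
  (forall n, pl n -> r n = n) -> (forall n, pm n -> q n = n) ->
  pure pl pm t -> ren r q t = t.
Proof.
  intros Hl Hm H. rewrite ren_subst_id. eapply subst_pure_id; [| |exact H]; firstorder congruence.
Qed.

Ltac under :=
  intros [|?]; simpl; try congruence; auto; try discriminate;
  intros; f_equal; auto.

(** A delayed term is typed through its reducts, so a reduct of the renamed term has to be pulled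
    back. Its free variables all have type [LD] or [MD]; it is therefore enough that [r'] and [q']
    invert [r] and [q], in both directions, on variables of these types. *)
Lemma ty_ren L Gl Gm k t :
  ty L Gl Gm k t -> forall Gl' Gm' r q r' q',
  (forall n, Gl' (r n) = Gl n) -> (forall n, Gm' (q n) = Gm n) ->
  (forall n, Gl n = LD -> r' (r n) = n) -> (forall n, Gm n = MD -> q' (q n) = n) ->
  (forall n, Gl' n = LD -> r (r' n) = n) -> (forall n, Gm' n = MD -> q (q' n) = n) ->
  ty L Gl' Gm' k (ren r q t).
Proof.
  induction 1 as [L Gl Gm k t Hp [w Hw] _ IH|L Gl Gm b n E|L Gl Gm b u _ IH
    |L Gl Gm e w _ IHe _ IHw|L Gl Gm o _ IH|L Gl Gm n y E Hp Hy|L Gl Gm p n E _ IH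
    |L Gl Gm b k t _ IHk _ IHt|L Gl Gm b a E|L Gl Gm b u _ IH|L Gl Gm b k _ IH
    |L Gl Gm u _ IH|L Gl Gm u _ IH|L Gl Gm t _ IH];
    intros Gl' Gm' r q r' q' Hl Hm Il Im Jl Jm; simpl.
  - assert (Hp' : pure (dl Gl') (dm Gm') (ren r q t)).
    { apply pure_ren. eapply pure_impl; [| |exact Hp]; unfold dl, dm; congruence. }
    apply ty_delay; auto.
    + exists (ren r q w). now apply wh_ren.
    + intros L' t' -> P.
      replace t' with (ren r q (ren r' q' t')).
      * eapply IH; eauto. apply (par_ren _ _) with (r := r') (q := q') in P.
        rewrite ren_ren, (ren_pure_id t _ _ _ _ Il Im Hp) in P. exact P.
      * rewrite ren_ren. apply (ren_pure_id t' _ _ _ _ Jl Jm).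
        eapply par_pure; eassumption.
  - apply ty_var. congruence.
  - apply ty_mu, (IH _ _ _ _ r' (up_ren q')); auto; under.
  - apply ty_erase; eauto.
  - apply ty_lam, (IH _ _ _ _ (up_ren r') q'); auto; under.
  - apply ty_zy; [congruence| |now apply chN_ren].
    apply pure_ren. eapply pure_impl; [| |exact Hp]; unfold dl, dm; congruence.
  - apply ty_inst; [congruence|eauto].
  - eapply ty_jump; eauto.
  - apply ty_kvar; congruence.
  - apply ty_klam, (IH _ _ _ _ (up_ren r') q'); auto; under.
  - eapply ty_wk; eauto.
  - change (lam (mu (lvar 0))) with tm_I. apply ty_wI. eauto.
  - apply ty_wmu, (IH _ _ _ _ r' (up_ren q')); auto; under.
  - apply ty_elam, (IH _ _ _ _ (up_ren r') q'); auto; under.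
Qed.

Lemma ty_weak_l x L Gl Gm k t :
  x <> LD -> ty L Gl Gm k t -> ty L (scons x Gl) Gm k (ren S id_ren t).
Proof.
  (* [pred] fails to invert [S] only at 0, and the hypothesis on [x] keeps that variable from having
     type [LD]. *)
  intros Hx H. apply (ty_ren _ _ _ _ _ H) with (r' := pred) (q' := id_ren); auto.
  intros [|n]; simpl; congruence.
Qed.

Lemma ty_weak_m x L Gl Gm k t :
  x <> MD -> ty L Gl Gm k t -> ty L Gl (scons x Gm) k (ren id_ren S t).
Proof.
  intros Hx H. apply (ty_ren _ _ _ _ _ H) with (r' := id_ren) (q' := pred); auto.
  intros [|n]; simpl; congruence.
Qed.

Lemma pure_lift_m x Gl Gm t :
  pure (dl Gl) (dm Gm) t -> pure (dl Gl) (dm (scons x Gm)) (ren id_ren S t).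
Proof. intros H. apply pure_ren. exact H. Qed.

(** Strengthening: brings the argument of a jump found under binders back to the outer context, as
    the typing of S6 requires. *)
Lemma ty_ren_inv L Gl' Gm' k t' :
  ty L Gl' Gm' k t' -> forall Gl Gm r q r' q' t, t' = ren r q t ->
  (forall n, r' (r n) = n) -> (forall n, q' (q n) = n) ->
  (forall n, Gl' (r n) = Gl n) -> (forall n, Gm' (q n) = Gm n) ->
  ty L Gl Gm k t.
Proof.
  induction 1 as [L Gl' Gm' k t' Hp Hw _ IH|L Gl' Gm' b n E|L Gl' Gm' b u _ IH
    |L Gl' Gm' e w _ IHe _ IHw|L Gl' Gm' o _ IH|L Gl' Gm' n y E Hp Hy|L Gl' Gm' p n E _ IH
    |L Gl' Gm' b k t' _ IHk _ IHt|L Gl' Gm' b a E|L Gl' Gm' b u _ IH|L Gl' Gm' b k _ IH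
    |L Gl' Gm' u _ IH|L Gl' Gm' u _ IH|L Gl' Gm' t' _ IH];
    intros Gl Gm r q r' q' t Et Il Im Hl Hm; subst.
  1: { apply ty_delay.
    - apply -> pure_ren in Hp. eapply pure_impl; [| |exact Hp]; unfold dl, dm; congruence.
    - eapply can_wh_ren_inv; eassumption.
    - intros L' t' -> P. eapply IH; eauto using par_ren. }
  all: try (destruct t as [m|m|t|t|t t2]; try discriminate; simpl in Et; inversion Et; subst).
  - apply ty_var. congruence.
  - eapply ty_mu, (IH _ _ r (up_ren q) r' (up_ren q')); auto; under.
  - eapply ty_erase; eauto.
  - eapply ty_lam, (IH _ _ (up_ren r) q (up_ren r') q'); auto; under.
  - destruct t as [m|m|t|t|t t3]; try discriminate. simpl in *. inversion H0; subst.
    apply ty_zy; [congruence| |].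
    + apply -> pure_ren in Hp. eapply pure_impl; [| |exact Hp]; unfold dl, dm; congruence.
    + apply (chN_ren _ r' q') in Hy.
      rewrite ren_ren, (ren_pure_id _ (fun _ => True) (fun _ => True)) in Hy;
        auto using pure_true.
  - destruct t2 as [m|m|t2|t2|t2 t3]; try discriminate. simpl in *. inversion H1; subst.
    apply ty_inst; [congruence|eauto].
  - eapply ty_jump; eauto.
  - apply ty_kvar; congruence.
  - eapply ty_klam, (IH _ _ (up_ren r) q (up_ren r') q'); auto; under.
  - eapply ty_wk; eauto.
  - destruct t as [m|m|t|t|t t3]; try discriminate.
    destruct t as [m|m|t|t|t t3']; try discriminate.
    destruct t as [[|m]|m|t|t|t t3']; try discriminate.
    apply ty_wI. eauto.
  - eapply ty_wmu, (IH _ _ r (up_ren q) r' (up_ren q')); auto; under.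
  - eapply ty_elam, (IH _ _ (up_ren r) q (up_ren r') q'); auto; under.
Qed.

Lemma ty_mono L Gl Gm k t : ty L Gl Gm k t -> forall L', L' <= L -> ty L' Gl Gm k t.
Proof.
  induction 1; intros L0 HL; try (econstructor; eauto; fail).
  apply ty_delay; auto. intros L' t' -> P. destruct L as [|L]; [inversion HL|].
  eapply H2; eauto. now apply le_S_n.
Qed.

(* [r] and [q] invert the substitution, which has to act on the variables of
   type [LD] or [MD] as a bijective renaming. *)
Record ty_sub L Gl Gm Gl' Gm' (sl sm : nat -> term) (r q : nat -> nat) : Prop := {
  ts_dl n : Gl n = LD -> exists m, sl n = lvar m /\ Gl' m = LD /\ r m = n;
  ts_dm n : Gm n = MD -> exists m, sm n = mvar m /\ Gm' m = MD /\ q m = n;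
  ts_jl m : Gl' m = LD -> Gl (r m) = LD /\ sl (r m) = lvar m;
  ts_jm m : Gm' m = MD -> Gm (q m) = MD /\ sm (q m) = mvar m;
  ts_z n : Gl n = LZ -> exists m, sl n = lvar m /\ Gl' m = LZ;
  ts_vl b n : Gl n = LV b -> ty L Gl' Gm' (kT b) (sl n);
  ts_vm b n : Gm n = MV b -> ty L Gl' Gm' (kK b) (sm n) }.

Lemma ty_sub_mono L L' Gl Gm Gl' Gm' sl sm r q :
  ty_sub L Gl Gm Gl' Gm' sl sm r q -> L' <= L -> ty_sub L' Gl Gm Gl' Gm' sl sm r q.
Proof. intros [] H. split; eauto using ty_mono. Qed.

Lemma ty_sub_lam x L Gl Gm Gl' Gm' sl sm r q :
  x <> LD -> ty_sub L Gl Gm Gl' Gm' sl sm r q ->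
  ty_sub L (scons x Gl) Gm (scons x Gl') Gm'
    (scons (lvar 0) (fun n => ren S id_ren (sl n)))
    (fun n => ren S id_ren (sm n)) (up_ren r) q.
Proof.
  intros Hx []. split.
  - intros [|n] E; simpl in *; [congruence|].
    destruct (ts_dl0 _ E) as [m [E1 [E2 E3]]]. exists (S m). rewrite E1. simpl. auto.
  - intros n E. destruct (ts_dm0 _ E) as [m [E1 [E2 E3]]]. exists m. rewrite E1. auto.
  - intros [|m] E; simpl in *; [congruence|].
    destruct (ts_jl0 _ E) as [E1 E2]. now rewrite E2.
  - intros m E. destruct (ts_jm0 _ E) as [E1 E2]. now rewrite E2.
  - intros [|n] E; simpl in *; [now exists 0|].
    destruct (ts_z0 _ E) as [m [E1 E2]]. exists (S m). now rewrite E1.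
  - intros b [|n] E; simpl in *; [now apply ty_var|]. apply ty_weak_l; auto.
  - intros b n E. apply ty_weak_l; auto.
Qed.

Lemma ty_sub_mu x L Gl Gm Gl' Gm' sl sm r q :
  x <> MD -> ty_sub L Gl Gm Gl' Gm' sl sm r q ->
  ty_sub L Gl (scons x Gm) Gl' (scons x Gm')
    (fun n => ren id_ren S (sl n))
    (scons (mvar 0) (fun n => ren id_ren S (sm n))) r (up_ren q).
Proof.
  intros Hx []. split.
  - intros n E. destruct (ts_dl0 _ E) as [m [E1 [E2 E3]]]. exists m. rewrite E1. auto.
  - intros [|n] E; simpl in *; [congruence|].
    destruct (ts_dm0 _ E) as [m [E1 [E2 E3]]]. exists (S m). rewrite E1. simpl. auto.
  - intros m E. destruct (ts_jl0 _ E) as [E1 E2]. now rewrite E2.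
  - intros [|m] E; simpl in *; [congruence|].
    destruct (ts_jm0 _ E) as [E1 E2]. now rewrite E2.
  - intros n E. destruct (ts_z0 _ E) as [m [E1 E2]]. exists m. now rewrite E1.
  - intros b n E. apply ty_weak_m; auto.
  - intros b [|n] E; simpl in *; [now apply ty_kvar|]. apply ty_weak_m; auto.
Qed.

Lemma ty_subst L Gl Gm k t :
  ty L Gl Gm k t -> forall Gl' Gm' sl sm r q,
  ty_sub L Gl Gm Gl' Gm' sl sm r q -> ty L Gl' Gm' k (subst sl sm t).
Proof.
  induction 1 as [L Gl Gm k t Hp [w Hw] _ IH|L Gl Gm b n E|L Gl Gm b u _ IH
    |L Gl Gm e w _ IHe _ IHw|L Gl Gm o _ IH|L Gl Gm n y E Hp Hy|L Gl Gm p n E _ IH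
    |L Gl Gm b k t _ IHk _ IHt|L Gl Gm b a E|L Gl Gm b u _ IH|L Gl Gm b k _ IH
    |L Gl Gm u _ IH|L Gl Gm u _ IH|L Gl Gm t _ IH];
    intros Gl' Gm' sl sm r q Hs; simpl.
  all: assert (Pp : forall t, pure (dl Gl) (dm Gm) t ->
                  pure (dl Gl') (dm Gm') (subst sl sm t)) by
    (intros v Hv; eapply pure_subst; [| |exact Hv]; intros n' E';
      [destruct (ts_dl _ _ _ _ _ _ _ _ _ Hs _ E') as [m [-> [E1 _]]]
      |destruct (ts_dm _ _ _ _ _ _ _ _ _ Hs _ E') as [m [-> [E1 _]]]]; exact E1).
  - apply ty_delay; auto.
    + exists (subst sl sm w). now apply wh_subst.
    + intros L' t' -> P.
      (* On a delayed term the substitution is a bijective renaming, and [par] creates no free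
         variables, so the reduct can be pulled back and substituted again. *)
      replace t' with (subst sl sm (ren r q t')).
      * eapply IH; eauto using ty_sub_mono. apply (par_ren _ _) with (r := r) (q := q) in P.
        rewrite ren_subst, (subst_pure_id t (dl Gl) (dm Gm)) in P; auto; intros n E.
        -- destruct (ts_dl _ _ _ _ _ _ _ _ _ Hs _ E) as [m [-> [_ <-]]]. reflexivity.
        -- destruct (ts_dm _ _ _ _ _ _ _ _ _ Hs _ E) as [m [-> [_ <-]]]. reflexivity.
      * rewrite subst_ren.
        apply (subst_pure_id t' (dl Gl') (dm Gm')); [| |eapply par_pure; eauto];
          intros n E; eapply Hs; exact E.
  - eapply ts_vl; eassumption.
  - eapply ty_mu, IH, ty_sub_mu; [discriminate|exact Hs].
  - eapply ty_erase; eauto.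
  - eapply ty_lam, IH, ty_sub_lam; [discriminate|exact Hs].
  - destruct (ts_z _ _ _ _ _ _ _ _ _ Hs _ E) as [m [-> E1]].
    apply ty_zy; auto using chN_subst.
  - destruct (ts_z _ _ _ _ _ _ _ _ _ Hs _ E) as [m [-> E1]].
    apply ty_inst; eauto.
  - eapply ty_jump; eauto.
  - eapply ts_vm; eassumption.
  - eapply ty_klam, IH, ty_sub_lam; [discriminate|exact Hs].
  - eapply ty_wk; eauto.
  - change (lam (mu (lvar 0))) with tm_I. apply ty_wI. eauto.
  - eapply ty_wmu, IH, ty_sub_mu; [discriminate|exact Hs].
  - eapply ty_elam, IH, ty_sub_lam; [discriminate|exact Hs].
Qed.

(** * Subject reduction *)

Ltac no_wh :=
  match goal with
  | H : can_wh _ |- _ =>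
    let W := fresh "W" in destruct H as [? W]; inversion W; subst; clear W; try no_wh
  | H : wh (lvar _) _ |- _ => now inversion H
  | H : wh (mvar _) _ |- _ => now inversion H
  | H : wh (lam _) _ |- _ => now inversion H
  | H : wh (mu _) _ |- _ => now inversion H
  end.

Lemma ty_mvar L Gl Gm k a :
  ty L Gl Gm k (mvar a) -> exists b, Gm a = MV b /\ (k = kK b \/ k = kW).
Proof.
  intros H. inversion H; subst; try no_wh; eauto.
  match goal with H : ty _ _ _ (kK _) _ |- _ => inversion H; subst end; try no_wh; eauto.
Qed.

(** S6 may select any jump, so every one of them must be typed. As [occ] keeps [v] within the scope
    of the outer variables, strengthening carries its typing out of each binder. *)
Lemma ty_occ L Gl Gm k t : ty L Gl Gm k t -> forall a v, occ (app (mvar a) v) t ->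
  match Gm a with
  | MD => True
  | MV b => ty L Gl Gm (kT b) v
  | MN => False
  end.
Proof.
  assert (Pocc : forall L Gl Gm t a v, pure (dl Gl) (dm Gm) t -> occ (app (mvar a) v) t ->
    match Gm a with MD => True | MV b => ty L Gl Gm (kT b) v | MN => False end).
  { intros L0 Gl0 Gm0 u a v Hp Ho. apply (occ_pure _ _ Ho) in Hp.
    destruct Hp as [E _]. simpl in E. unfold dm in E. now rewrite E. }
  assert (Pl : forall x L Gl Gm a v, match Gm a with MD => True
      | MV b => ty L (scons x Gl) Gm (kT b) (ren S id_ren v) | MN => False end ->
    match Gm a with MD => True | MV b => ty L Gl Gm (kT b) v | MN => False end).
  { intros x L0 Gl0 Gm0 a v. destruct (Gm0 a); auto. intros H.
    eapply (ty_ren_inv _ _ _ _ _ H _ _ S id_ren pred id_ren); reflexivity. }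
  assert (Pm : forall x L Gl Gm a v, match Gm a with MD => True
      | MV b => ty L Gl (scons x Gm) (kT b) (ren id_ren S v) | MN => False end ->
    match Gm a with MD => True | MV b => ty L Gl Gm (kT b) v | MN => False end).
  { intros x L0 Gl0 Gm0 a v. destruct (Gm0 a); auto. intros H.
    eapply (ty_ren_inv _ _ _ _ _ H _ _ id_ren S id_ren pred); reflexivity. }
  induction 1 as [L Gl Gm k t Hp Hw _ IH|L Gl Gm b n E|L Gl Gm b u _ IH
    |L Gl Gm e w He IHe _ IHw|L Gl Gm o _ IH|L Gl Gm n y E Hp Hy|L Gl Gm p n E Hp IH
    |L Gl Gm b k t Hk IHk Ht IHt|L Gl Gm b a E|L Gl Gm b u _ IH|L Gl Gm b k _ IH
    |L Gl Gm u _ IH|L Gl Gm u _ IH|L Gl Gm t _ IH]; intros a0 v Ho;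
    try (inversion Ho; subst; eauto; fail).
  - exact (Pocc _ _ _ _ _ _ Hp Ho).
  - inversion Ho as [| |? ? H| |]; subst. apply (Pm (MV b)). exact (IH (S a0) _ H).
  - inversion Ho as [| | |? ? ? H|? ? ? H]; subst; [|exact (IHe _ _ H)|exact (IHw _ _ H)].
    apply ty_mvar in He. destruct He as [? [_ [?|?]]]; discriminate.
  - inversion Ho as [|? ? H| | |]; subst. apply (Pl LZ). exact (IH a0 _ H).
  - inversion Ho as [| | |? ? ? H|? ? ? H]; subst; [inversion H|exact (Pocc _ _ _ _ _ _ Hp H)].
  - inversion Ho as [| | |? ? ? H|? ? ? H]; subst; [|exact (IH _ _ H)|inversion H].
    apply ty_mvar in Hp. destruct Hp as [? [_ [?|?]]]; discriminate.
  - inversion Ho as [| | |? ? ? H|? ? ? H]; subst; [|exact (IHk _ _ H)|exact (IHt _ _ H)].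
    apply ty_mvar in Hk. destruct Hk as [b' [-> [E|E]]]; inversion E; now subst.
  - inversion Ho as [|? ? H| | |]; subst. apply (Pl (LV b)). exact (IH a0 _ H).
  - exact (IH _ _ Ho).
  - inversion Ho as [| | |? ? ? H|? ? ? H]; subst; [|exact (IH _ _ H)].
    inversion H as [|? ? H1| | |]; subst. inversion H1 as [| |? ? H2| |]; subst. inversion H2.
  - inversion Ho as [| |? ? H| |]; subst. apply (Pm MN). exact (IH (S a0) _ H).
  - inversion Ho as [|? ? H| | |]; subst. apply (Pl LN). exact (IH a0 _ H).
Qed.

Lemma ty_sO_not_lam L Gl Gm t : ~ ty L Gl Gm (kT sO) (lam t).
Proof. intros H; inversion H; subst; no_wh. Qed.

(** No term of sort [sO] is an abstraction, so outside the untyped parts the pattern of S5 arises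
    only for continuations of sort [sN]. *)
Lemma ty_has_mvar_lam L Gl Gm k t : ty L Gl Gm k t -> forall a,
  has_mvar_lam a t -> Gm a = MD \/ Gm a = MV sN.
Proof.
  induction 1 as [L Gl Gm k t Hp Hw _ IH|L Gl Gm b n E|L Gl Gm b u _ IH
    |L Gl Gm e w He IHe _ IHw|L Gl Gm o _ IH|L Gl Gm n y E Hp Hy|L Gl Gm p n E Hp IH
    |L Gl Gm b k t Hk IHk Ht IHt|L Gl Gm b a E|L Gl Gm b u _ IH|L Gl Gm b k _ IH
    |L Gl Gm u _ IH|L Gl Gm u _ IH|L Gl Gm t _ IH]; intros a0 Ho; simpl in Ho;
    try contradiction; try (now apply IH); try (exact (IH (S a0) Ho)).
  - left. exact (pure_has_mvar_lam _ _ _ _ Hp Ho).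
  - destruct Ho as [[-> _]|[Ho|Ho]]; auto.
    apply ty_mvar in He. destruct He as [? [_ [?|?]]]; discriminate.
  - destruct Ho as [[? _]|[Ho|Ho]]; [discriminate|contradiction|].
    left. exact (pure_has_mvar_lam _ _ _ _ Hp Ho).
  - destruct Ho as [[-> [? ?]]|[Ho|Ho]]; [discriminate|auto|contradiction].
  - destruct Ho as [[-> [w ->]]|[Ho|Ho]]; auto.
    apply ty_mvar in Hk. destruct Hk as [[|] [Eb [E|E]]]; inversion E; subst; auto.
    now apply ty_sO_not_lam in Ht.
  - destruct Ho as [[? _]|[Ho|Ho]]; [discriminate|contradiction|auto].
Qed.

Lemma ty_sub_lvar x L Gl Gm v :
  x <> LD -> (x = LZ -> exists m, v = lvar m /\ Gl m = LZ) ->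
  (forall b, x = LV b -> ty L Gl Gm (kT b) v) ->
  ty_sub L (scons x Gl) Gm Gl Gm (scons v lvar) mvar S id_ren.
Proof.
  intros Hx Hz Hv. split; unfold id_ren; eauto using ty_kvar.
  - intros [|n] E; simpl in *; [congruence|eauto].
  - intros [|n] E; simpl in *; eauto.
  - intros b [|n] E; simpl in *; auto using ty_var.
Qed.

Lemma ty_sub_mvar L Gl Gm b k :
  ty L Gl Gm (kK b) k ->
  ty_sub L Gl (scons (MV b) Gm) Gl Gm lvar (scons k mvar) id_ren S.
Proof.
  intros Hk. split; unfold id_ren; eauto using ty_var.
  - intros [|n] E; simpl in *; [discriminate|eauto].
  - intros b' [|n] E; simpl in *; [congruence|auto using ty_kvar].
Qed.

Lemma ty_sub_mvar_mu L Gl Gm b b' k :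
  ty L Gl (scons (MV b') Gm) (kK b) k ->
  ty_sub L Gl (scons (MV b) Gm) Gl (scons (MV b') Gm)
    lvar (scons k (fun n => mvar (S n))) id_ren id_ren.
Proof.
  intros Hk. split; unfold id_ren; eauto using ty_var.
  - intros [|n] E; simpl in *; [discriminate|eauto].
  - intros [|n] E; simpl in *; [discriminate|eauto].
  - intros b1 [|n] E; simpl in *; [congruence|auto using ty_kvar].
Qed.

Lemma ty_sub_S5 L Gl Gm x b b' k :
  x <> LD -> ty L (scons x Gl) (scons (MV b') Gm) (kK b) k ->
  ty_sub L Gl (scons (MV b) Gm) (scons x Gl) (scons (MV b') Gm)
    (fun n => lvar (S n)) (scons k (fun n => mvar (S n))) pred id_ren.
Proof.
  intros Hx Hk. split; unfold id_ren; eauto using ty_var.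
  - intros [|n] E; simpl in *; [discriminate|eauto].
  - intros [|m] E; simpl in *; [congruence|auto].
  - intros [|n] E; simpl in *; [discriminate|eauto].
  - intros b1 [|n] E; simpl in *; [congruence|auto using ty_kvar].
Qed.

(** Excludes S2 on typed terms. *)
Lemma ty_kU_not_mu L Gl Gm t : ~ ty L Gl Gm kU (mu t).
Proof. intros H; inversion H; subst; no_wh. Qed.

(** Excludes S1 on instances and S3 on jumps. *)
Lemma ty_kT_mvar_app L Gl Gm b a t : ~ ty L Gl Gm (kT b) (app (mvar a) t).
Proof.
  intros H; inversion H; subst; try no_wh;
    match goal with H : ty _ _ _ _ (mvar _) |- _ =>
      apply ty_mvar in H; destruct H as [? [_ [?|?]]]; discriminate end.
Qed.

Lemma rule_mu_ty L Gl Gm b u t :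
  ty L Gl (scons (MV b) Gm) kU u -> rule (mu u) t -> ty L Gl Gm (kT b) t.
Proof.
  intros H R. inversion R as [? ? C| | |? E| | |? Hl E|u0 v Hf]; subst.
  - inversion C.
  - now apply ty_kU_not_mu in H.
  (* S5 forces [b] to be [sN]. The new lambda-variable is a continuation of type [LZ], and the old
     mu-variable becomes a function that applies its argument to it before jumping at sort [sO]. *)
  - apply (ty_has_mvar_lam _ _ _ _ _ H) in Hl. simpl in Hl.
    destruct Hl as [Hl|Hl]; inversion Hl; subst.
    apply ty_lam, ty_mu. eapply ty_subst; [exact H|]. apply ty_sub_S5; [discriminate|].
    apply ty_klam. eapply ty_jump; [now apply ty_kvar|].
    apply ty_inst; [reflexivity|]. now apply ty_var.
  (* S6: the argument of the selected jump has the sort of the whole [mu], and strengthening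
     discards the bound mu-variable. *)
  - pose proof (ty_occ _ _ _ _ _ H _ _ (occ_S6 _ _ Hf)) as Ht. simpl in Ht.
    apply (ty_ren_inv _ _ _ _ _ Ht _ _ id_ren S id_ren pred); reflexivity.
Qed.

(** S5 and S6 both need a jump to the bound variable, which the type [MN] forbids. *)
Lemma rule_wmu_ty L Gl Gm u t :
  ty L Gl (scons MN Gm) kU u -> ~ rule (mu u) t.
Proof.
  intros H R. inversion R as [? ? C| | |? E| | |? Hl E|u0 v Hf]; subst.
  - inversion C.
  - now apply ty_kU_not_mu in H.
  - apply (ty_has_mvar_lam _ _ _ _ _ H) in Hl. simpl in Hl. now destruct Hl.
  - exact (ty_occ _ _ _ _ _ H _ _ (occ_S6 _ _ Hf)).
Qed.

Lemma rule_erase_ty L Gl Gm e w t :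
  ty L Gl Gm kE e -> rule (app e w) t -> ty L Gl Gm (kT sN) t.
Proof.
  intros He R. inversion He; subst.
  - exfalso. inversion R as [? ? C| | | | | | |]; subst; try inversion C; subst; no_wh.
  - inversion R as [? ? C| | | | | | |]; subst. inversion C; subst.
    eapply ty_subst; [eassumption|]. apply ty_sub_lvar; discriminate.
Qed.

Lemma rule_inst_ty L Gl Gm p n t :
  Gl n = LZ -> ty L Gl Gm (kT sN) p -> rule (app p (lvar n)) t ->
  ty L Gl Gm (kT sO) t.
Proof.
  intros E Hp R. inversion R as [? ? C| | | | | | |]; subst.
  - inversion C; subst. inversion Hp; subst; try no_wh.
    eapply ty_subst; [eassumption|]. apply ty_sub_lvar; try discriminate. eauto.
  (* C_mu lowers the sort of the bound continuation from [sN] to [sO]. *)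
  - inversion Hp; subst; try no_wh.
    apply ty_mu. eapply ty_subst; [eassumption|]. apply ty_sub_mvar_mu.
    apply ty_klam. eapply ty_jump; [now apply ty_kvar|].
    apply ty_inst; [exact E|now apply ty_var].
  - now apply ty_kT_mvar_app in Hp.
Qed.

Lemma rule_jump_ty L Gl Gm b k p t :
  ty L Gl Gm (kK b) k -> ty L Gl Gm (kT b) p -> rule (app k p) t ->
  ty L Gl Gm kU t.
Proof.
  intros Hk Hp R. inversion R as [? ? C| | | | | | |]; subst.
  - inversion C; subst. inversion Hk; subst; try no_wh.
    eapply ty_subst; [eassumption|]. apply ty_sub_lvar; try discriminate. congruence.
  - inversion Hk; subst; no_wh.
  - inversion Hk; subst; no_wh.
  - now apply ty_kT_mvar_app in Hp.
  - inversion Hp; subst; try no_wh.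
    eapply ty_subst; [eassumption|]. apply ty_sub_mvar.
    apply ty_klam. eapply ty_jump; [|now apply ty_var].
    inversion Hk; subst; try no_wh. now apply ty_kvar.
Qed.

Lemma par_tm_I t : par tm_I t -> t = tm_I.
Proof.
  intros H. inversion H as [| |? ? H1| | | |]; subst.
  inversion H1 as [| | |? ? H2| |? ? ? H2 R|]; subst; inversion H2; subst; [reflexivity|].
  inversion R as [? ? C| | |? E| | |? Hl E|u0 v Hf]; subst; [inversion C|destruct Hl|].
  match goal with E : subst (scons (app _ (ren _ _ ?v)) _) _ ?u = _ |- _ =>
    pose proof (occ_S6 u v Hf) as O; rewrite E in O; inversion O end.
Qed.

Lemma rule_lvar_app n t w : ~ rule (app (lvar n) t) w.
Proof. intros R; inversion R as [? ? C| | | | | | |]; inversion C. Qed.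

Lemma par_lam_inv t w : par (lam t) w -> exists t', w = lam t' /\ par t t'.
Proof. inversion 1; subst; eauto. Qed.

(** The index drops because a delayed term guarantees its reducts only at the smaller index; the
    other cases use the typing of each rule. *)
Lemma par_ty L0 Gl Gm k t :
  ty L0 Gl Gm k t -> forall L t', L0 = S L -> par t t' -> ty L Gl Gm k t'.
Proof.
  induction 1 as [L0 Gl Gm k t Hp Hw H _|L0 Gl Gm b n E|L0 Gl Gm b u _ IH
    |L0 Gl Gm e w _ IHe _ IHw|L0 Gl Gm o _ IH|L0 Gl Gm n y E Hp Hy|L0 Gl Gm p n E _ IH
    |L0 Gl Gm b k t _ IHk _ IHt|L0 Gl Gm b a E|L0 Gl Gm b u _ IH|L0 Gl Gm b k _ IH
    |L0 Gl Gm u _ IH|L0 Gl Gm u _ IH|L0 Gl Gm t _ IH]; intros L t' EL P.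
  - eauto.
  - inversion P; subst. now apply ty_var.
  - inversion P; subst; [apply ty_mu; eauto|]. eapply rule_mu_ty; eauto.
  - inversion P; subst; [apply ty_erase; eauto|]. eapply rule_erase_ty; eauto.
  - apply par_lam_inv in P. destruct P as [o' [-> P]]. apply ty_lam; eauto.
  - inversion P as [| | | |? ? ? ? P1 P2| |? ? ? ? ? P1 P2 R]; subst; inversion P1; subst.
    + apply ty_zy; [exact E|eapply par_pure; eauto|eapply chN_par; eauto].
    + now apply rule_lvar_app in R.
  - inversion P as [| | | |? ? ? ? P1 P2| |? ? ? ? ? P1 P2 R]; subst; inversion P2; subst.
    + apply ty_inst; eauto.
    + eapply rule_inst_ty; eauto.
  - inversion P; subst; [eapply ty_jump; eauto|]. eapply rule_jump_ty; eauto.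
  - inversion P; subst. now apply ty_kvar.
  - apply par_lam_inv in P. destruct P as [o' [-> P]]. apply ty_klam; eauto.
  - eapply ty_wk; eauto.
  - inversion P as [| | | |? ? ? ? P1 P2| |? ? ? ? ? P1 P2 R]; subst;
      apply par_tm_I in P1; subst.
    + apply ty_wI; eauto.
    (* Beta on [tm_I] leaves a [mu] over the weakened argument, so its variable does not occur and
       receives [MN]. *)
    + inversion R as [? ? C| | | | | | |]; subst. inversion C; subst. simpl.
      apply ty_wmu, ty_weak_m; [discriminate|eauto].
  - inversion P; subst; [apply ty_wmu; eauto|].
    exfalso. eapply rule_wmu_ty; [|eassumption]. eapply IH; eauto.
  - apply par_lam_inv in P. destruct P as [o' [-> P]]. apply ty_elam; eauto.
Qed.

(** Head expansion at the same index. By [par_wh], a reduct of [t] either still has a head step to a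
    reduct of [t1] or is itself a reduct of [t1], and [par_ty] types the latter one index lower. *)
Lemma ty_wh L : forall Gl Gm k t t1,
  pure (dl Gl) (dm Gm) t -> wh t t1 -> ty L Gl Gm k t1 -> ty L Gl Gm k t.
Proof.
  induction L as [|L IH]; intros Gl Gm k t t1 Hp W H; apply ty_delay; eauto;
    try (eexists; eassumption); [discriminate|].
  intros L' t' E P. injection E as <-.
  destruct (par_wh _ _ _ P W) as [[t1' [W' P']]|P'].
  - eapply IH; [eapply par_pure; eauto|exact W'|]. eapply par_ty; eauto.
  - eapply par_ty; eauto.
Qed.

Lemma ty_whs L Gl Gm k t t1 :
  whs t t1 -> pure (dl Gl) (dm Gm) t -> ty L Gl Gm k t1 -> ty L Gl Gm k t.
Proof.
  induction 1 as [|t u v W Ws IH]; auto. intros Hp H.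
  eapply ty_wh; [exact Hp|exact W|]. apply IH; auto.
  eapply par_pure; [|exact Hp]. apply step_par. now apply wh_step.
Qed.

(** * Typed normal terms *)

Lemma beta_not_normal u v : ~ normal (app (lam u) v).
Proof. intros N. apply (can_wh_normal (app (lam u) v)); auto. eexists; constructor. Qed.

Lemma rule_not_normal t t' : rule t t' -> ~ normal t.
Proof. intros R N. apply (N t'). now constructor. Qed.

Ltac not_normal :=
  exfalso; match goal with
  | N : normal ?t, H : can_wh ?t |- _ => exact (can_wh_normal _ H N)
  | N : normal (app (lam _) _) |- _ => exact (beta_not_normal _ _ N)
  | N : normal (app (mu _) _) |- _ =>
      eapply rule_not_normal; [apply rule_C_mu|exact N]
  end.

Lemma normal_sN L Gl Gm t :
  (forall n, Gl n <> LV sN) -> ty L Gl Gm (kT sN) t -> normal t ->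
  (exists u, t = mu u /\ ty L Gl (scons (MV sN) Gm) kU u) \/
  (exists o, t = lam o /\ ty L (scons LZ Gl) Gm (kT sO) o).
Proof.
  intros HG H N. inversion H; subst; eauto.
  - not_normal.
  - exfalso. eapply HG; eassumption.
  - destruct (normal_app _ _ N) as [Ne _].
    match goal with H : ty _ _ _ kE _ |- _ => inversion H; subst end; not_normal.
Qed.

Lemma normal_kU L Gl Gm u :
  ty L Gl Gm kU u -> normal u ->
  exists b a p, u = app (mvar a) p /\ Gm a = MV b /\ ty L Gl Gm (kT b) p.
Proof.
  intros H N. inversion H; subst; [not_normal|].
  destruct (normal_app _ _ N) as [Nk _].
  match goal with H : ty _ _ _ (kK _) _ |- _ => inversion H; subst end;
    [not_normal| |not_normal].
  eauto 8.
Qed.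

Lemma normal_sO L Gl Gm t :
  (forall n b, Gl n <> LV b) -> ty L Gl Gm (kT sO) t -> normal t ->
  (exists u, t = mu u /\ ty L Gl (scons (MV sO) Gm) kU u) \/
  (exists n y, t = app (lvar n) y /\ Gl n = LZ /\ pure (dl Gl) (dm Gm) y /\ chN y).
Proof.
  intros HG H N. inversion H; subst; eauto 8.
  - not_normal.
  - exfalso. eapply HG; eassumption.
  - destruct (normal_app _ _ N) as [Np _].
    match goal with H : ty _ _ _ (kT sN) _ |- _ =>
      apply normal_sN in H; [|auto|auto];
      destruct H as [[u [-> _]]|[u [-> _]]] end; not_normal.
Qed.

Lemma ty_normal L t :
  ty L (fun _ => LD) (fun _ => MD) (kT sN) t -> normal t ->
  exists m, t = lam (app (lvar 0) (church m)).
Proof.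
  intros H N. apply normal_sN in H; [|discriminate|exact N].
  destruct H as [[u [-> H]]|[o [-> H]]].
  (* A remaining [mu] would have as body a jump to its own variable with a normal argument of sort
     [sN]: S4 fires if that is a [mu], S5 if it is an abstraction. *)
  - exfalso. pose proof (normal_mu _ N) as Nu.
    destruct (normal_kU _ _ _ _ H Nu) as [b [[|a] [p [-> [E Hp]]]]]; [|discriminate].
    injection E as <-. destruct (normal_app _ _ Nu) as [_ Np].
    apply normal_sN in Hp; [|discriminate|exact Np].
    destruct Hp as [[u [-> _]]|[o [-> _]]].
    + eapply rule_not_normal; [apply rule_S4|exact Nu].
    + eapply rule_not_normal; [apply rule_S5|exact N]. simpl. eauto.
  - pose proof (normal_lam _ N) as No.
    apply normal_sO in H; [|intros [|n] b; discriminate|exact No].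
    destruct H as [[u [-> H]]|[[|n] [y [-> [E [Hp Hy]]]]]]; [|..|discriminate].
    + exfalso. pose proof (normal_mu _ No) as Nu.
      destruct (normal_kU _ _ _ _ H Nu) as [b [[|a] [p [-> [E Hp]]]]]; [|discriminate].
      injection E as <-. destruct (normal_app _ _ Nu) as [_ Np].
      apply normal_sO in Hp; [|intros [|n] b; discriminate|exact Np].
      destruct Hp as [[u [-> _]]|[n [y [-> [E [Hp Hy]]]]]].
      * eapply rule_not_normal; [apply rule_S4|exact Nu].
      * (* [S6] applies: [mu] does not bind any variable of [y]. *)
        assert (Ey : ren id_ren S (ren id_ren pred (app (lvar n) y)) = app (lvar n) y).
        { rewrite ren_ren.
          eapply (ren_pure_id _ (fun _ => True) (dm (scons (MV sO) (fun _ => MD)))).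
          - reflexivity.
          - intros [|m] E'; [discriminate|reflexivity].
          - split; [exact I|]. eapply pure_impl; [| |exact Hp]; auto. }
        rewrite <- Ey in No.
        exact (rule_not_normal _ _ (rule_S6 (lvar 0) _ eq_refl) No).
    + destruct (normal_app _ _ No) as [_ Ny].
      destruct (chN_normal _ Hy Ny) as [m ->]. eauto.
Qed.

(** * The reducts of [F_N s] *)

(* Renames the variables of a term that has [y] as lambda-variable 0 when it is
   put below the binders of [x], [y] and [d] in [F_N]. *)
Definition ren_F (n : nat) : nat :=
  match n with 0 => 1 | S m => 3 + m end.

Definition jump_F : term :=
  app (mvar 0) (app (app (app (lvar 0) (lam (lam (app (lvar 0) (lvar 2))))) tm_id) (mvar 0)).

(* The body of [F_N s] below the binders of [x] and [y], with [(s y)] replaced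
   by [u]; [w] is [(I jump_F)] or its reduct. *)
Definition F_body (w u : term) : term :=
  mu (app (mvar 0)
       (app (app (app (lvar 0) (lam (app (lvar 2) (ren ren_F S u)))) tm_id) w)).

Inductive abort_F : term -> Prop :=
| abort_F_I : abort_F (app tm_I jump_F)
| abort_F_mu : abort_F (mu (ren id_ren S jump_F)).

Definition succ_y (s : term) : term := app (ren S id_ren s) (lvar 0).

Lemma F_N_body s : F_N s = lam (lam (F_body (app tm_I jump_F) (succ_y s))).
Proof. unfold F_N, F_body, succ_y. simpl. rewrite ren_ren. reflexivity. Qed.

(** The free variables of the reduct lie in the images of [r] and [q], where the left inverses undo
    the renaming. *)
Lemma par_ren_inv r q r' q' t t' :
  (forall n, r' (r n) = n) -> (forall n, q' (q n) = n) ->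
  par (ren r q t) t' -> exists t0, t' = ren r q t0 /\ par t t0.
Proof.
  intros Ir Iq P. exists (ren r' q' t'). split.
  - rewrite ren_ren. symmetry.
    apply (ren_pure_id t' (fun n => exists m, n = r m) (fun n => exists m, n = q m)).
    + intros n [m ->]. now rewrite Ir.
    + intros n [m ->]. now rewrite Iq.
    + eapply par_pure; [exact P|]. apply pure_ren.
      eapply pure_impl; [| |apply pure_true]; eauto.
  - apply (par_ren _ _) with (r := r') (q := q') in P. rewrite ren_ren in P.
    rewrite (ren_pure_id t (fun _ => True) (fun _ => True)) in P; auto using pure_true.
Qed.

Ltac par_inv :=
  match goal with
  | P : par (lvar _) _ |- _ => inversion P; subst; clear P
  | P : par (mvar _) _ |- _ => inversion P; subst; clear P
  | P : par tm_id _ |- _ => inversion P; subst; clear P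
  | P : par (lam _) _ |- _ => inversion P; subst; clear P
  | P : par (app _ _) _ |- _ => inversion P; subst; clear P
  | R : rule (app _ _) _ |- _ =>
      let C := fresh "C" in
      inversion R as [? ? C| | | | | | |]; subst; clear R; inversion C; fail
  end.

Lemma par_jump_F t : par jump_F t -> t = jump_F.
Proof.
  unfold jump_F. intros P. repeat par_inv. reflexivity.
Qed.

(* Rules out [S6] at the binder of the mu-variable [a]. *)
Fixpoint all_jumps_use (a : nat) (t : term) : Prop :=
  match t with
  | lvar _ | mvar _ => True
  | lam u => all_jumps_use a u
  | mu u => all_jumps_use (S a) u
  | app u v => (u = mvar a -> ~ pure (fun _ => True) (fun n => n <> a) v)
               /\ all_jumps_use a u /\ all_jumps_use a v
  end.

Lemma all_jumps_use_occ w t : occ w t -> forall a v,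
  w = app (mvar a) v -> all_jumps_use a t -> ~ pure (fun _ => True) (fun n => n <> a) v.
Proof.
  induction 1; intros a v -> H0; simpl in H0; try (eapply IHocc; [reflexivity|tauto]).
  - tauto.
  - intros Hp. eapply IHocc; [reflexivity|exact H0|]. apply pure_ren. exact Hp.
  - intros Hp. eapply IHocc; [reflexivity|exact H0|]. apply pure_ren.
    eapply pure_impl; [| |exact Hp]; auto.
Qed.

Lemma pure_all_jumps_use t : forall a pl pm,
  (forall n, pm n -> n <> a) -> pure pl pm t -> all_jumps_use a t.
Proof.
  induction t; simpl; intros a pl pm Ha H; auto.
  - eauto.
  - eapply IHt; [|exact H]. intros [|m]; simpl; auto.
  - destruct H as [H1 H2]. repeat split; eauto. intros -> _. exact (Ha a H1 eq_refl).
Qed.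

Lemma pure_ren_S t : pure (fun _ => True) (fun n => n <> 0) (ren id_ren S t).
Proof. apply pure_ren. eapply pure_impl; [| |apply pure_true]; auto. Qed.

Lemma all_jumps_use_S6 u t :
  all_jumps_use 0 u -> (forall v, u <> mu v) -> ~ has_mvar_lam 0 u -> ~ rule (mu u) t.
Proof.
  intros Hj Hm Hl R. inversion R as [? ? C| | |? E| | |? Hl' E|u0 v Hf]; subst.
  - inversion C.
  - now eapply Hm.
  - auto.
  - exact (all_jumps_use_occ _ _ (occ_S6 _ _ Hf) _ _ eq_refl Hj (pure_ren_S t)).
Qed.

Lemma abort_F_par w w' : abort_F w -> par w w' -> abort_F w'.
Proof.
  intros H P. destruct H.
  - inversion P as [| | | |? ? ? ? P1 P2| |? ? ? ? ? P1 P2 R]; subst;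
      apply par_tm_I in P1; apply par_jump_F in P2; subst; [constructor|].
    inversion R as [? ? C| | | | | | |]; subst. inversion C; subst. constructor.
  - assert (Q : forall t, par (ren id_ren S jump_F) t -> t = ren id_ren S jump_F).
    { intros t H. apply (par_ren_inv _ _ id_ren pred) in H; try reflexivity.
      destruct H as [t0 [-> H]]. now apply par_jump_F in H as ->. }
    inversion P as [| | |? ? P1| |? ? ? P1 R|]; subst; apply Q in P1; subst; [constructor|].
    exfalso. revert R. apply all_jumps_use_S6.
    + eapply pure_all_jumps_use; [|apply pure_ren_S]. auto.
    + discriminate.
    + intros Hl. eapply pure_has_mvar_lam in Hl; [|apply pure_ren_S]. now apply Hl.
Qed.

(** No rule fires at the binder: both jumps to its variable mention it again in their arguments,
    against S6, and neither argument is an abstraction, against S5. Only [w] and [u] can evolve. *)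
Lemma F_body_par w u t :
  abort_F w -> par (F_body w u) t ->
  exists w' u', t = F_body w' u' /\ abort_F w' /\ par u u'.
Proof.
  intros Hw P. unfold F_body in P.
  assert (Q : forall t, par (app (mvar 0)
       (app (app (app (lvar 0) (lam (app (lvar 2) (ren ren_F S u)))) tm_id) w)) t ->
     exists w' u', mu t = F_body w' u' /\ abort_F w' /\ par u u').
  { clear P t. intros t P.
    assert (HR : forall u', par (ren ren_F S u) u' -> exists u0, u' = ren ren_F S u0 /\ par u u0).
    (* The left inverse of [ren_F]: it sends 1 to 0 and [3 + m] to [S m]. *)
    { intros u'. apply (par_ren_inv _ _ (fun n => match n with 1 => 0 | _ => n - 2 end) pred);
        [|reflexivity]. intros [|n]; reflexivity. }
    revert P. generalize (abort_F_par w). intros Ha P.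
    repeat par_inv.
    match goal with H : par (ren _ _ _) _ |- _ => apply HR in H; destruct H as [u0 [-> Pu]] end.
    eexists _, _. repeat split; eauto. }
  inversion P as [| | |? ? P1| |? ? ? P1 R|]; subst; [eauto|].
  apply Q in P1. destruct P1 as [w' [u' [E [Hw' Hu']]]].
  injection E as ->. exfalso. revert R. apply all_jumps_use_S6.
  - simpl. assert (all_jumps_use 0 (ren ren_F S u')).
    { eapply (pure_all_jumps_use _ _ (fun _ => True) (fun n => n <> 0)); auto.
      apply pure_ren. eapply pure_impl; [| |apply pure_true]; auto. }
    destruct Hw'; simpl; repeat split; try discriminate; try tauto.
  - discriminate.
  - simpl. assert (~ has_mvar_lam 0 (ren ren_F S u')).
    { intros Hl. eapply (pure_has_mvar_lam _ _ (fun _ => True) (fun n => n <> 0)) in Hl; auto.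
      apply pure_ren. eapply pure_impl; [| |apply pure_true]; auto. }
    destruct Hw'; simpl; intros Hh;
      repeat match goal with
        | H : _ \/ _ |- _ => destruct H
        | H : _ /\ _ |- _ => destruct H
        | H : exists _, _ |- _ => destruct H
        end; try discriminate; contradiction.
Qed.

Definition F_like (w u : term) : term := lam (lam (F_body w u)).

Lemma F_like_par w u t :
  abort_F w -> par (F_like w u) t ->
  exists w' u', t = F_like w' u' /\ abort_F w' /\ par u u'.
Proof.
  intros Hw P. apply par_lam_inv in P. destruct P as [t1 [-> P]].
  apply par_lam_inv in P. destruct P as [t2 [-> P]].
  apply F_body_par in P; auto. destruct P as [w' [u' [-> [Hw' Hu]]]].
  exists w', u'. auto.
Qed.

Definition inst (u y : term) : term := subst (scons y lvar) mvar u.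

(* The body of [(Y (F_like w u) y)] once it is weakly head normal. *)
Definition F_unfold (w u y : term) : term :=
  app (mvar 0)
    (app (app (app (ren id_ren S y)
                   (lam (ren S S (app (app turing_Y (F_like w u)) (inst u y))))) tm_id)
         (subst (scons (ren id_ren S y) lvar) mvar w)).

Lemma F_like_whs w u y :
  abort_F w ->
  whs (app (app (F_like w u) (app turing_Y (F_like w u))) y) (mu (F_unfold w u y)).
Proof.
  intros Hw. eapply whs_step; [apply wh_app, wh_beta|]. simpl.
  eapply whs_step; [apply wh_beta|]. 
  match goal with |- whs ?a ?b => replace a with b; [apply whs_refl|] end.
  unfold F_unfold, F_like, F_body, inst, tm_id, turing_Y, turing_A.
  destruct Hw; unfold jump_F, tm_I, tm_id; subst_eq.
Qed.

(** The weak head reduct of [turing_Y], at which a parallel step may stop. *)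
Definition turing_B : term :=
  lam (app (lvar 0) (app (app turing_A turing_A) (lvar 0))).

Lemma turing_B_wh t : wh (app turing_B t) (app t (app turing_Y t)).
Proof. apply wh_beta. Qed.

Lemma turing_Y_wh : wh turing_Y turing_B.
Proof. apply wh_beta. Qed.

Lemma Y_F_like_whs w u y :
  abort_F w -> whs (app (app turing_Y (F_like w u)) y) (mu (F_unfold w u y)).
Proof.
  intros Hw. eapply whs_step; [apply wh_app, wh_app, turing_Y_wh|].
  eapply whs_step; [apply wh_app, turing_B_wh|]. now apply F_like_whs.
Qed.

Lemma par_turing_A t : par turing_A t -> t = turing_A.
Proof. unfold turing_A. intros P. repeat par_inv. reflexivity. Qed.

(* A parallel step does not exhaust the weak head reduction of the unfolding:
   this is what makes the typing of [Y F] productive. *)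
Lemma Y_F_like_par w u y t :
  abort_F w -> par (app (app turing_Y (F_like w u)) y) t ->
  exists w' u' y', abort_F w' /\ par u u' /\ par y y' /\
    whs t (mu (F_unfold w' u' y')).
Proof.
  intros Hw P.
  assert (PY : forall t, par turing_Y t -> t = turing_Y \/ t = turing_B).
  { intros t0 H. inversion H as [| | | |? ? ? ? P1 P2| |? ? ? ? ? P1 P2 R]; subst;
      apply par_turing_A in P1; apply par_turing_A in P2; subst; auto.
    inversion R as [? ? C| | | | | | |]; subst. inversion C; subst. auto. }
  (* One pass gets at most as far as the reduct of [F_like] applied to its fixed point. That the
     head is not a mu-variable excludes S1 once the term is applied to [y]. *)
  assert (PF : forall t, par (app turing_Y (F_like w u)) t ->
    exists w' u' a b, t = app a b /\ (forall n, a <> mvar n) /\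
      abort_F w' /\ par u u' /\
      forall y, whs (app t y) (mu (F_unfold w' u' y))).
  { intros t0 H. inversion H as [| | | |? ? ? ? P1 P2| |? ? ? ? ? P1 P2 R]; subst;
      apply F_like_par in P2; auto; destruct P2 as [w0 [u0 [-> [Hw' Pu]]]];
      apply PY in P1; exists w0, u0.
    - eexists _, _. split; [reflexivity|]. destruct P1 as [->| ->]; (split; [discriminate|]);
        repeat split; auto; intros v; [now apply Y_F_like_whs|].
      eapply whs_step; [apply wh_app, turing_B_wh|]. now apply F_like_whs.
    - destruct P1 as [->| ->];
        inversion R as [? ? C| | | | | | |]; subst; inversion C; subst.
      eexists _, _. split; [reflexivity|]. split; [discriminate|].
      repeat split; auto. intros v. now apply F_like_whs. }
  inversion P as [| | | |? ? ? ? P1 P2| |? ? ? ? ? P1 P2 R]; subst;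
    apply PF in P1; destruct P1 as [w0 [u0 [a [b [-> [Ha [Hw' [Pu W]]]]]]]].
  - eauto 8.
  - exfalso. inversion R as [? ? C| | | | | | |]; subst; [inversion C|]. now eapply Ha.
Qed.

(** * Typing the recursion *)

Definition succ_like (u : term) : Prop := forall y, chN y -> chN (inst u y).

Lemma succ_like_par u u' : succ_like u -> par u u' -> succ_like u'.
Proof.
  intros Hu P y Hy. eapply chN_par; [exact (Hu y Hy)|]. unfold inst.
  apply par_beta; auto using par_refl.
Qed.

Notation dead_l := (fun _ : nat => LD).
Notation dead_m := (fun _ : nat => MD).

Lemma pure_dead t : pure (dl dead_l) (dm dead_m) t.
Proof. eapply pure_impl; [| |apply pure_true]; reflexivity. Qed.

Lemma pure_lift_dead_m x t : pure (dl dead_l) (dm (scons x dead_m)) (ren id_ren S t).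
Proof. apply pure_lift_m, pure_dead. Qed.

Lemma F_unfold_ty L w u y :
  abort_F w -> chN y ->
  ty L dead_l dead_m (kT sN) (app (app turing_Y (F_like w u)) (inst u y)) ->
  ty L dead_l dead_m (kT sN) (mu (F_unfold w u y)).
Proof.
  intros Hw Hy H. apply ty_mu.
  (* By [chN_iter] and head expansion, a selector is typed like its first argument. *)
  assert (HA : forall A, ty L dead_l (scons (MV sN) dead_m) kE A ->
      pure (dl dead_l) (dm (scons (MV sN) dead_m)) A ->
      ty L dead_l (scons (MV sN) dead_m) kE (app (app (ren id_ren S y) A) tm_id)).
  { intros A HA Hp. eapply ty_whs; [apply chN_iter, chN_ren, Hy| |exact HA].
    repeat split; auto using pure_lift_dead_m. }
  unfold F_unfold. eapply ty_jump; [now apply ty_kvar|]. apply ty_erase.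
  - apply HA.
    + apply ty_elam. apply (ty_ren _ _ _ _ _ H) with (r' := pred) (q' := pred); auto.
      * intros [|n]; simpl; congruence.
      * intros [|n]; simpl; congruence.
    + apply pure_ren. eapply pure_impl; [| |apply pure_true]; reflexivity.
  - assert (HJ : ty L dead_l (scons (MV sN) dead_m) kU
                   (subst (scons (ren id_ren S y) lvar) mvar jump_F)).
    { unfold jump_F. simpl. eapply ty_jump; [now apply ty_kvar|].
      apply ty_erase; [|eapply ty_wk, ty_kvar; reflexivity].
      apply HA.
      - apply ty_elam, ty_lam, ty_zy; [reflexivity| |repeat apply chN_ren; exact Hy].
        rewrite !ren_ren. apply pure_ren. eapply pure_impl; [| |apply pure_true]; reflexivity.
      - simpl. split; [exact I|].
        rewrite !ren_ren. apply pure_ren. eapply pure_impl; [| |apply pure_true]; reflexivity. }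
    destruct Hw.
    + apply ty_wI. exact HJ.
    + rewrite subst_mu. apply ty_wmu.
      replace (subst _ _ _) with (ren id_ren S (subst (scons (ren id_ren S y) lvar) mvar jump_F)).
      * apply ty_weak_m; [discriminate|exact HJ].
      * unfold jump_F, tm_id. subst_eq.
Qed.

(** The term is delayed, and each of its parallel reducts head-reduces to an unfolding whose
    recursive call is typed by induction at the smaller index. Quantifying over [w], [u] and [y]
    allows for reductions inside them. *)
Lemma Y_F_like_ty L : forall w u y, abort_F w -> succ_like u -> chN y ->
  ty L dead_l dead_m (kT sN) (app (app turing_Y (F_like w u)) y).
Proof.
  induction L as [|L IH]; intros w u y Hw Hu Hy;
    (apply ty_delay; [apply pure_dead|eexists; apply wh_app, wh_app, turing_Y_wh|]);
    [discriminate|].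
  intros L' t E P. injection E as <-.
  apply Y_F_like_par in P; auto. destruct P as [w' [u' [y' [Hw' [Pu [Py W]]]]]].
  eapply ty_whs; [exact W|apply pure_dead|].
  pose proof (succ_like_par _ _ Hu Pu) as Hu'. pose proof (chN_par _ _ Hy Py) as Hy'.
  apply F_unfold_ty; auto.
Qed.

Lemma succ_y_like s : represents_succ s -> succ_like (succ_y s).
Proof.
  intros Hs y Hy. unfold inst, succ_y. simpl. rewrite subst_ren.
  unfold id_ren. simpl. rewrite subst_id. now apply succ_chN.
Qed.

(** Each step costs one index, so typing at all indices survives a reduction of any length. *)
Lemma red_normal_ty t u : red t u -> normal u ->
  (forall L, ty L dead_l dead_m (kT sN) t) ->
  exists m, u = lam (app (lvar 0) (church m)).
Proof.
  intros R N H. apply clos_rt_rt1n in R. induction R as [t|t t' u St R IH].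
  - exact (ty_normal 0 t (H 0) N).
  - apply IH; auto. intros L. eapply par_ty; [apply (H (S L))|reflexivity|now apply step_par].
Qed.

(** * Reaching every integer *)

Lemma whs_red t u : whs t u -> red t u.
Proof.
  induction 1; [apply rt_refl|]. eapply rt_trans; [apply rt_step, wh_step|]; eassumption.
Qed.

Lemma red_lambda_red t u : red_lambda t u -> red t u.
Proof.
  induction 1 as [t u H|t|t u v _ IH1 _ IH2]; [|apply rt_refl|eapply rt_trans; eassumption].
  apply rt_step. induction H; [apply closure_root, rule_C_lambda; assumption|..];
    constructor; assumption.
Qed.

Lemma red_mu t t' : red t t' -> red (mu t) (mu t').
Proof. apply (closure_map _ mu). intros; now apply closure_mu. Qed.

Lemma red_app_l t t' u : red t t' -> red (app t u) (app t' u).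
Proof. apply (closure_map _ (fun t => app t u)). intros; now apply closure_app_l. Qed.

Lemma red_app_r t u u' : red u u' -> red (app t u) (app t u').
Proof. apply (closure_map _ (app t)). intros; now apply closure_app_r. Qed.

Lemma red_beta t u v : subst (scons u lvar) mvar t = v -> red (app (lam t) u) v.
Proof. intros <-. apply rt_step, closure_root, rule_C_lambda. constructor. Qed.

Lemma Y_F_N_unfold s y :
  red (app (P_N s) y) (mu (F_unfold (app tm_I jump_F) (succ_y s) y)).
Proof.
  apply whs_red. unfold P_N. rewrite F_N_body. apply Y_F_like_whs. constructor.
Qed.

Lemma church_chN k : chN (church k).
Proof. exists k. apply st_refl. Qed.

Lemma red_succ s k : represents_succ s ->
  red (app (P_N s) (church k)) (app (P_N s) (church (S k))).
Proof.
  intros Hs. eapply rt_trans; [apply Y_F_N_unfold|]. unfold F_unfold.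
  set (Z := app (app turing_Y _) _).
  eapply rt_trans.
  { apply red_mu, red_app_r. eapply rt_trans.
    - apply red_app_l, whs_red, chN_iter, chN_ren, church_chN.
    - apply red_beta. rewrite subst_ren. symmetry. exact (ren_subst_id Z id_ren S). }
  (* The body [lvar 0] makes S6 select the outermost jump. *)
  eapply rt_trans; [apply rt_step, closure_root, (rule_S6 (lvar 0) Z); reflexivity|].
  unfold Z, P_N. rewrite F_N_body. apply red_app_r.
  unfold inst, succ_y. simpl. rewrite subst_ren. unfold id_ren. simpl. rewrite subst_id.
  apply red_lambda_red, Hs.
Qed.

(** S6 erases the whole context of the inner jump, even though the bound mu-variable is free there;
    only [v] has to avoid it. *)
Lemma step_S6_arg e v :
  step (mu (app (mvar 0) (app e (app tm_I (app (mvar 0) (ren id_ren S v)))))) v.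
Proof.
  apply closure_root.
  replace e with (subst (scons (app (mvar 0) (ren id_ren S v)) lvar) mvar (ren S id_ren e)).
  - apply (rule_S6 (app (mvar 0) (app (ren S id_ren e) (app tm_I (lvar 0))))). simpl. auto.
  - rewrite subst_ren. apply subst_id.
Qed.

Lemma red_result s y :
  chN y -> red (app (P_N s) y) (lam (app (lvar 0) (ren S id_ren y))).
Proof.
  intros Hy. eapply rt_trans; [apply Y_F_N_unfold|]. unfold F_unfold.
  set (e := app (app _ (lam (ren S S _))) _).
  set (r := lam (app (lvar 0) _)).
  (* Only the inner selector is reduced: it erases the mu-variable passed to it, so the inner jump
     becomes eligible for S6. *)
  eapply rt_trans with (mu (app (mvar 0) (app e (app tm_I (app (mvar 0) (ren id_ren S r)))))).
  - apply red_mu, red_app_r, red_app_r.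
    change (red (app tm_I (subst (scons (ren id_ren S y) lvar) mvar jump_F))
                (app tm_I (app (mvar 0) (ren id_ren S r)))).
    apply red_app_r. apply (red_app_r (mvar 0)).
    eapply rt_trans.
    + apply red_app_l, whs_red. apply (chN_iter (ren id_ren S y)), chN_ren, Hy.
    + apply red_beta. unfold r. subst_eq.
  - apply rt_step, step_S6_arg.
Qed.

Theorem theorem11 :
  forall s : term, represents_succ s ->
    red_set (app (P_N s) (church 0))
            (fun t => exists m : nat, t = lam (app (lvar 0) (church m))).
Proof.
  intros s Hs. split; [|split].
  - intros u [m ->]. apply normal_church_result.
  - intros u [m ->]. pose proof (red_result s _ (church_chN m)) as H. rewrite ren_church in H.
    eapply rt_trans; [|exact H]. clear H.
    (* [P_N s] counts up from 0 to [m] before the inner jump is taken. *)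
    induction m as [|m IH]; [apply rt_refl|].
    eapply rt_trans; [exact IH|now apply red_succ].
  - intros u N R. eapply red_normal_ty; [exact R|exact N|].
    intros L. unfold P_N. rewrite F_N_body. apply Y_F_like_ty.
    + constructor.
    + now apply succ_y_like.
    + apply church_chN.
Qed.
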